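(* Let $\lambda>0$. If $X_0\in W^{1,1}_{\mathrm{Imm}}(\mathbb S,\mathbb R^2)$, then the solution $X$ on $[0,T_0]$ (for any $T_0>0$) of $\partial_tX=F_\lambda(X)$ with $X(0)=X_0$ remains immersed, i.e. $X\in C^1([0,T_0],W^{1,1}_{\mathrm{Imm}}(\mathbb S,\mathbb R^2))$.
   Context: $\mathbb S=[0,1]/\{0\sim 1\}$ is the circle. $W^{1,1}(\mathbb S,\mathbb R^2)$ is the usual Sobolev space, with elements identified with their absolutely continuous representatives, and $W^{1,1}_{\mathrm{Imm}}(\mathbb S,\mathbb R^2)=\{\gamma\in W^{1,1}(\mathbb S,\mathbb R^2):|\gamma'(u)|>0\text{ for a.e. }u\}$; ''immersed'' means belonging to this set. Length: $\mathcal L(\gamma)=\int_0^1|\gamma'(u)|\,du$. For $\lambda>0$, $\mathcal G^\lambda:\mathbb S\to\mathbb R$ is the 1-periodic extension of $$\mathcal G^\lambda(x)=-\frac{\cosh\left(\frac{|x|-1/2}{\lambda}\right)}{2\lambda\sinh\left(\frac1{2\lambda}\right)},\qquad x\in[0,1].$$ For $\mathcal L(\gamma)>0$ set $\rho_\gamma(u)=\frac1{\mathcal L(\gamma)}\int_0^u|\gamma'(\tau)|\,d\tau$ and $$(\gamma*_\gamma\mathcal G^\lambda)(u)=\int_0^1\gamma(v)\,\mathcal G^\lambda(\rho_\gamma(v)-\rho_\gamma(u))\,\frac{|\gamma'(v)|}{\mathcal L(\gamma)}\,dv .$$ Define $F_\lambda(\gamma)=-\frac{1}{\lambda^2}\left(\gamma+\gamma*_\gamma\mathcal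 G^\lambda\right)$ if $\mathcal L(\gamma)\ne0$ and $F_\lambda(\gamma)=0$ if $\mathcal L(\gamma)=0$. A solution on an interval $I$ is a curve $X\in C^1(I,W^{1,1}(\mathbb S,\mathbb R^2))$ satisfying the equation as an ODE in $W^{1,1}(\mathbb S,\mathbb R^2)$. *)

(* Defs.v *)
From HB Require Import structures.
From mathcomp Require Import all_boot all_order all_algebra.
From mathcomp Require Import all_classical all_reals all_analysis.

Set Implicit Arguments.
Unset Strict Implicit.
Unset Printing Implicit Defensive.

Import Order.TTheory GRing.Theory Num.Theory.
Import numFieldNormedType.Exports.

Local Open Scope classical_set_scope.
Local Open Scope ring_scope.

(* The Euclidean norm (the canonical norm of 'rV[R]_2 is the sup norm). *)
Definition enorm (R : realType) (x : 'rV[R]_2) : R :=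
  Num.sqrt (\sum_(i < 2) x 0 i ^+ 2).

Definition coshR (R : realType) (x : R) : R := (expR x + expR (- x)) / 2.
Definition sinhR (R : realType) (x : R) : R := (expR x - expR (- x)) / 2.

(* A curve on the circle [0,1]/{0 ~ 1} is a function R -> 'rV[R]_2 of which
   only the values on [0,1] matter; W11 below imposes the same value at 0
   and 1.  Its derivative is the classical derivative derive1 g, which exists
   almost everywhere for absolutely continuous g; where g is not
   differentiable derive1 g is a default value, and this null set is irrelevant
   for everything below. *)

Definition abs_continuous (R : realType) (a b : R) (g : R -> 'rV[R]_2) : Prop :=
  forall e : R, 0 < e -> exists2 d : R, 0 < d &
    forall (n : nat) (s t : 'I_n -> R),
      (forall i, a <= s i /\ s i <= t i /\ t i <= b) ->
      trivIset [set: 'I_n] (fun i => `]s i, t i[%classic) ->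
      \sum_(i < n) (t i - s i) < d ->
      \sum_(i < n) enorm (g (t i) - g (s i)) < e.

Definition W11 (R : realType) : set (R -> 'rV[R]_2) :=
  [set g | abs_continuous 0 1 g /\ g 0 = g 1].
Arguments W11 : clear implicits.

Definition W11norm (R : realType) (g : R -> 'rV[R]_2) : R :=
  \int[@lebesgue_measure R]_(u in `[0, 1]) enorm (g u) +
  \int[@lebesgue_measure R]_(u in `[0, 1]) enorm (derive1 g u).

Definition W11Imm (R : realType) : set (R -> 'rV[R]_2) :=
  [set g | W11 R g /\
    {ae (@lebesgue_measure R), forall u : R, `[0, 1]%classic u -> 0 < enorm (derive1 g u)}].
Arguments W11Imm : clear implicits.

Definition curve_length (R : realType) (g : R -> 'rV[R]_2) : R :=
  \int[@lebesgue_measure R]_(u in `[0, 1]) enorm (derive1 g u).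

(* x - floor x is the representative of x modulo 1 in [0,1[; the formula takes
   the same value at 0 and 1, so this is its 1-periodic extension. *)
Definition Green (R : realType) (lam x : R) : R :=
  let y := x - (Num.floor x)%:~R in
  - (coshR ((`|y| - 1 / 2) / lam) / (2 * lam * sinhR (1 / (2 * lam)))).

Definition rho (R : realType) (g : R -> 'rV[R]_2) (u : R) : R :=
  (curve_length g)^-1 *
  \int[@lebesgue_measure R]_(tau in `[0, u]) enorm (derive1 g tau).

Definition Gconv (R : realType) (lam : R) (g : R -> 'rV[R]_2) (u : R) :
    'rV[R]_2 :=
  \row_(i < 2) \int[@lebesgue_measure R]_(v in `[0, 1])
    (g v 0 i * Green lam (rho g v - rho g u) *
     (enorm (derive1 g v) / curve_length g)).

Definition Fvf (R : realType) (lam : R) (g : R -> 'rV[R]_2) : R -> 'rV[R]_2 :=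
  if curve_length g == 0 then fun _ => 0
  else fun u => - (1 / lam ^+ 2) *: (g u + Gconv lam g u).

(* X t u is the point of parameter u on the curve at time t.  Limits are taken
   in W^{1,1}, relatively to I (hence one-sided at the endpoints of I). *)
Definition continuous_W11 (R : realType) (I : set R)
    (X : R -> R -> 'rV[R]_2) : Prop :=
  (forall t, I t -> W11 R (X t)) /\
  (forall t, I t ->
     (fun s => W11norm (fun u => X s u - X t u)) @ within I (nbhs t) --> (0 : R)).

Definition is_derive_W11 (R : realType) (I : set R)
    (X Y : R -> R -> 'rV[R]_2) : Prop :=
  (forall t, I t -> W11 R (X t) /\ W11 R (Y t)) /\
  (forall t, I t ->
     (fun s => W11norm (fun u => (s - t)^-1 *: (X s u - X t u) - Y t u))
       @ within I t^' --> (0 : R)).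

(* C^1(I, S) for a subset S of W^{1,1}. *)
Definition C1_into (R : realType) (I : set R) (S : set (R -> 'rV[R]_2))
    (X : R -> R -> 'rV[R]_2) : Prop :=
  (forall t, I t -> S (X t)) /\
  (exists2 Y : R -> R -> 'rV[R]_2, is_derive_W11 I X Y & continuous_W11 I Y).

Definition is_solution (R : realType) (lam : R) (I : set R)
    (X : R -> R -> 'rV[R]_2) : Prop :=
  C1_into I (W11 R) X /\ is_derive_W11 I X (fun t => Fvf lam (X t)).

(* Main.v *)
Require Import Defs.
From HB Require Import structures.
From mathcomp Require Import all_boot all_order all_algebra.
From mathcomp Require Import all_classical all_reals all_analysis.
From mathcomp Require Import measurable_realfun.
From mathcomp Require Import ring lra.
Set Implicit Arguments.
Unset Strict Implicit.
Unset Printing Implicit Defensive.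
Import Order.TTheory GRing.Theory Num.Theory.
Import numFieldNormedType.Exports.
Local Open Scope classical_set_scope.
Local Open Scope ring_scope.

(** The velocity of a curve is slaved to its own speed.  In the convolution
    Gconv the parameter [u] enters only through the normalized arclength
    [rho g u], and this makes the derivative of [Fvf lam g] at [u] bounded by
    [C * |g' u|] for almost every [u], with [C] depending on [lam] alone
    ([Fvf_derivative_bound]).  If the equation could be differentiated in [u]
    and read pointwise, the speed [q] of the solution at [u] would satisfy
    [|q'| <= C * q] in time, hence [q t >= exp (- C t) * q 0 > 0].

    The equation holds in W^{1,1} only, so the speed at a given [u] need not be
    differentiable in time and the argument is integrated instead.  Fix a time
    [t0], let [E] be the set of parameters where the derivative of [X t0]
    vanishes, and let [m t] be the integral over [E] of the l1 norm of the
    derivative of [X t].  The W^{1,1} derivative in time gives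
    [|m s - m t| <= |s - t| * (2 * C * m t + o(1))] ([integral_norm1_step]).
    By a Gronwall argument run from [t0] back to [0] ([gronwall_zero]),
    [m t0 = 0] forces [m 0 = 0]: the derivative of [X0] vanishes almost
    everywhere on [E], so [E] is negligible because [X0] is immersed.

    Independence of [C] from the curve is what makes Gronwall work.  The kernel
    has constant total mass with respect to normalized arclength
    ([integral_Green_arclength]), so [g v] may be replaced by [g v - g u] in the
    increments of Gconv; that difference is at most the length [L] of the
    curve, which cancels the factor [1 / L] coming from the derivative of
    [rho g] ([Gconv_increment_le]).

    Two facts of real analysis support this.  An absolutely continuous function
    is the integral of its almost everywhere derivative ([abs_continuous_FTC]):
    it is a difference of nondecreasing continuous functions, the associated
    difference of Stieltjes measures is dominated by Lebesgue measure, and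
    Radon-Nikodym applies.  The classical derivative may fail to be Borel on the
    null set where it is a default value, yet its integrals agree with those of
    any Borel function almost everywhere equal to it
    ([ae_eq_Rintegral_measr]). *)

(** * Absolutely continuous functions are integrals of their derivatives *)

Definition real_abs_continuous (R : realType) (a b : R) (f : R -> R) : Prop :=
  forall e : R, 0 < e -> exists2 d : R, 0 < d &
    forall (n : nat) (s t : 'I_n -> R),
      (forall i, a <= s i /\ s i <= t i /\ t i <= b) ->
      trivIset [set: 'I_n] (fun i => `]s i, t i[%classic) ->
      \sum_(i < n) (t i - s i) < d ->
      \sum_(i < n) `|f (t i) - f (s i)| < e.

(** The subdivision intervals of a short interval form a disjoint family of small
    total length, to which absolute continuity applies. *)
Lemma abs_continuous_variation (R : realType) (a b : R) (f : R -> R) :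
  real_abs_continuous a b f -> forall e : R, 0 < e -> exists2 d : R, 0 < d &
  forall (c c' : R) (s : seq R), a <= c -> c' <= b -> c' - c < d -> itv_partition c c' s ->
    variation c c' f s < e.
Proof.
move=> fac e e0; have [d d0 H] := fac e e0; exists d => // c c' s ac cb cd p.
rewrite /variation big_mkord /=.
have pc := p; case: pc => sp /eqP sl.
have mono i j : (i <= j)%N -> (j < (size s).+1)%N ->
    nth c' (c :: s) i <= nth c' (c :: s) j.
  move=> ij js; apply: (@sorted_leq_nth _ <=%R) => //=.
  - exact: le_trans.
  - by apply: sub_path sp => x y /ltW.
  - by rewrite inE (leq_ltn_trans ij).
have bnd i : (i < (size s).+1)%N ->
    c <= nth c' (c :: s) i /\ nth c' (c :: s) i <= c'.
  by move=> ?; split; [exact: itv_partition_nth_ge|exact: itv_partition_nth_le].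
apply: (H (size s) (fun i => nth c' (c :: s) i) (fun i => nth c' (c :: s) i.+1)).
- move=> i; have [? ?] := bnd i (ltnW (ltn_ord i) : (i < (size s).+1)%N).
  have [? ?] := bnd i.+1 (ltn_ord i : (i.+1 < (size s).+1)%N).
  split; [exact: (le_trans ac)|split; last exact: le_trans cb].
  exact: (mono i i.+1 (leqnSn i) (ltn_ord i : (i.+1 < (size s).+1)%N)).
- apply/trivIsetP => i j _ _; wlog ij : i j / (i < j)%N => [hwlog|_].
    rewrite neq_ltn => /orP[ij|ji]; first by apply: hwlog => //; rewrite neq_ltn ij.
    by rewrite setIC; apply: hwlog => //; rewrite neq_ltn ji.
  apply/seteqP; split => // x [] /=.
  rewrite !in_itv/= => /andP[_ xi] /andP[jx _].
  have : nth c' (c :: s) i.+1 <= nth c' (c :: s) j by apply: mono => //; exact/ltnW/ltn_ord.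
  by rewrite leNgt (lt_trans jx xi).
- rewrite -(big_mkord xpredT (fun i => nth c' (c :: s) i.+1 - nth c' (c :: s) i)).
  rewrite telescope_sumr//= (_ : nth c' (c :: s) (size s) = c')//.
  by rewrite (itv_partition_nth_size _ p).
Qed.

(** Absolute continuity bounds the variation by 1 on every interval shorter than
    some [d], and finitely many intervals of length [d / 2] cover the given one. *)
Lemma abs_continuous_bounded_variation (R : realType) (a b : R) (f : R -> R) :
  a <= b -> real_abs_continuous a b f -> bounded_variation a b f.
Proof.
move=> ab fac; have [d d0 H] := abs_continuous_variation fac ltr01.
have small c c' : a <= c -> c <= c' -> c' <= b -> c' - c < d ->
    total_variation c c' f \is a fin_num.
  move=> ac cc' cb cd; apply/bounded_variationP => //.
  by exists 1 => _ [s ps <-]; exact/ltW/H.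
apply/bounded_variationP => //.
(* The variation is finite up to the n-th multiple of d / 2. *)
have step n : total_variation a (Num.min b (a + n%:R * (d / 2))) f \is a fin_num.
  elim: n => [|n IH].
    by rewrite mul0r addr0 (min_idPr ab) total_variationxx.
  set c := Num.min b _ in IH; set c' := Num.min b _.
  have d20 : 0 < d / 2 by rewrite divr_gt0.
  have ac : a <= c.
    by rewrite le_min ab lerDl mulr_ge0// ltW.
  have cc' : c <= c'.
    rewrite le_min ge_min lexx /= ge_min; apply/orP; right.
    by rewrite lerD2l ler_pM2r// ler_nat.
  rewrite (total_variationD _ ac cc') fin_numD IH small//.
    by rewrite ge_min lexx.
  rewrite /c /c'; have [h|h] := leP b (a + n%:R * (d / 2)).
    by apply: le_lt_trans d0; rewrite subr_le0 ge_min lexx.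
  rewrite ltrBlDr gt_min; apply/orP; right.
  rewrite -natr1 mulrDl mul1r; lra.
pose n := (Num.trunc ((b - a) / (d / 2))).+1.
have := step n; rewrite (min_idPl _)// -lerBlDl -ler_pdivrMr ?divr_gt0//.
by rewrite ltW// truncnS_gt.
Qed.

Lemma lebesgue_stieltjes_measure_itv (R : realType) (F : cumulative R R) (s t : R) :
  s <= t -> lebesgue_stieltjes_measure F `]s, t]%classic = (F t - F s)%:E.
Proof.
move=> st; rewrite /lebesgue_stieltjes_measure /measure_extension.
by rewrite measurable_mu_extE/=; [rewrite wlength_itv_bnd|exact: is_ocitv].
Qed.

(** Finite unions of half-open intervals form a ring of sets, in which every
    element splits into disjoint half-open intervals; [undup] turns the finite
    set of pieces into a family indexed by an ordinal. *)
Lemma ocitv_bigsetU_disjoint (R : realType) (A : nat -> set (ocitv_type R)) (n : nat) :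
  (forall i, ocitv (A i)) ->
  exists m (s t : 'I_m -> R), [/\ (forall i, s i <= t i),
    trivIset [set: 'I_m] (fun i => `]s i, t i]%classic) &
    \big[setU/set0]_(i < n) A i = \bigcup_i `]s i, t i]%classic].
Proof.
move=> oA.
have mU : measurable (\big[setU/set0]_(i < n) A i : set (SetRing.type (ocitv_type R))).
  by apply: bigsetU_measurable => i _; apply: SetRing.measurable_subring; exact: oA.
have [B [finB _ tB mB ->]] := SetRing.ring_finite_set mU.
have [X0 BX0] := (finite_seqP _).1 finB.
pose X := undup X0.
have BX : B = [set` X] by rewrite BX0; apply/seteqP; split => x /=; rewrite mem_undup.
pose F (i : 'I_(size X)) : set R := nth set0 X i.
have FX i : F i \in X by exact: mem_nth.
have FP i : exists p : R * R, p.1 <= p.2 /\ F i = `]p.1, p.2]%classic.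
  have /ocitvP[->|[p p12 ->]] : ocitv (F i).
    by apply: mB; rewrite BX inE /=; exact: FX.
    by exists (0, 0); split => //; rewrite set_itv_ge//= bnd_simp ltxx.
  by exists p; split => //; exact: ltW.
have [p pP] := choice FP.
exists (size X), (fun i => (p i).1), (fun i => (p i).2).
have pE : (fun i => `](p i).1, (p i).2]%classic) = F.
  by apply/funext => i; have [_ ->] := pP i.
split => [i||]; first by have [] := pP i.
- rewrite pE => i j _ _ ij; apply/val_inj/eqP.
  rewrite -(nth_uniq set0 (ltn_ord i) (ltn_ord j) (undup_uniq X0)); apply/eqP.
  by apply: tB => //; rewrite BX/=; exact: FX.
- rewrite pE BX; apply/seteqP; split => [x [Y YX Yx]|x [i _ Fx]].
    have YX' : (index Y X < size X)%N by rewrite index_mem.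
    by exists (Ordinal YX') => //; rewrite /F /= nth_index.
  by exists (F i) => //=; exact: FX.
Qed.

(** The outer measure provides a countable cover by half-open intervals of nearly
    optimal measure; a long enough finite part of the cover already has almost
    all its measure. *)
Lemma lebesgue_stieltjes_measure_approx (R : realType) (F : cumulative R R)
    (N : set (measurableTypeR R)) (e : R) :
  measurable N -> (lebesgue_stieltjes_measure F N < +oo)%E -> 0 < e ->
  exists m (s t : 'I_m -> R), [/\ (forall i, s i <= t i),
    trivIset [set: 'I_m] (fun i => `]s i, t i]%classic),
    (lebesgue_stieltjes_measure F (N `\` \bigcup_i `]s i, t i]%classic) <= e%:E)%E &
    (lebesgue_stieltjes_measure F (\bigcup_i `]s i, t i]%classic `\` N) <= e%:E)%E].
Proof.
set mu := lebesgue_stieltjes_measure F => mN Noo e0.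
have muD B C : measurable B -> measurable C -> C `<=` B -> (mu B < +oo)%E ->
    (mu (B `\` C) = mu B - mu C)%E.
  move=> mB mC CB Boo; rewrite -[in RHS](setIidr CB).
  exact: (@measureD _ _ _ (lebesgue_stieltjes_measure F)).
have Nfin : mu N \is a fin_num by rewrite ge0_fin_numE.
have : (mu N < mu N + e%:E)%E by rewrite lteDl.
move=> /ereal_inf_lt[_ [/= A [oA NA] <-] Ae].
have mA i : measurable (A i : set (measurableTypeR R)).
  by apply: sub_sigma_algebra; exact: oA.
set U := \bigcup_k A k in NA.
have mU : measurable (U : set (measurableTypeR R)) by exact: bigcupT_measurable.
have muU : (mu U < mu N + e%:E)%E.
  apply: le_lt_trans Ae; rewrite (eq_eseriesr (g := mu \o A)).
    exact: measure_sigma_subadditive.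
  by move=> i _; rewrite /= /mu /lebesgue_stieltjes_measure /measure_extension measurable_mu_extE.
have Ufin : mu U \is a fin_num.
  by rewrite ge0_fin_numE// (lt_le_trans muU)// leey.
pose V n := \big[setU/set0]_(i < n.+1) A i.
have mV n : measurable (V n : set (measurableTypeR R)).
  by apply: bigsetU_measurable => i _; exact: mA.
have VU n : V n `<=` U by exact: bigsetU_bigcup.
have Vcvg : (mu \o V) n @[n --> \oo] --> mu U.
  rewrite /U -bigcup_bigsetU_bigcup; apply: nondecreasing_cvg_mu => //.
    by rewrite bigcup_bigsetU_bigcup.
  by move=> n m nm; apply/subsetPset; exact: subset_bigsetU.
have [n Vn] : exists n, (mu U - e%:E < mu (V n))%E.
  have : (mu U - e%:E < mu U)%E by rewrite lteBlDr// lteDl.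
  move=> Ue; apply: contrapT => /forallNP h; move: Ue; apply/negP; rewrite -leNgt.
  rewrite -[leLHS](cvg_lim _ Vcvg)//; apply: lime_le; first by apply/cvg_ex; exists (mu U).
  by apply: nearW => n; rewrite leNgt; apply/negP; exact: h.
have [m [s [t [st tst VE]]]] := ocitv_bigsetU_disjoint n.+1 oA.
exists m, s, t; rewrite -VE -/(V n); split => //.
- apply: (@le_trans _ _ (mu (U `\` V n))).
    by apply: le_measure; rewrite ?inE; [exact: measurableD..|exact: setSD].
  rewrite muD// -?ge0_fin_numE// leeBlDr; last first.
    by rewrite ge0_fin_numE// (le_lt_trans (le_measure mu _ _ (VU n))) ?inE// -ge0_fin_numE.
  by rewrite addeC ltW// -lteBlDr.
- apply: (@le_trans _ _ (mu (U `\` N))).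
    by apply: le_measure; rewrite ?inE; [exact: measurableD..|exact: setSD].
  rewrite muD// -?ge0_fin_numE//.
  by rewrite leeBlDl// ltW.
Qed.

Definition clamp (R : realType) (a b x : R) : R := Num.max a (Num.min x b).

Lemma clamp_itv (R : realType) (a b x : R) : a <= b -> a <= clamp a b x <= b.
Proof. by move=> ab; rewrite /clamp le_max lexx/= ge_max ab ge_min lexx orbT. Qed.

Lemma clamp_id (R : realType) (a b x : R) : a <= x <= b -> clamp a b x = x.
Proof. by case/andP=> ax xb; rewrite /clamp (min_idPl xb) (max_idPr ax). Qed.

Lemma clamp_nd (R : realType) (a b : R) : {homo clamp a b : x y / x <= y}.
Proof.
move=> x y xy; by rewrite /clamp ge_max le_max lexx /= le_max le_min !ge_min xy lexx !orbT.
Qed.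

Lemma clamp_lipschitz (R : realType) (a b x y : R) : x <= y ->
  clamp a b y - clamp a b x <= y - x.
Proof.
move=> xy; rewrite /clamp /Num.max /Num.min.
by repeat (case: ifPn; rewrite -?leNgt); lra.
Qed.

Lemma clamp_continuous (R : realType) (a b : R) : a <= b -> continuous (clamp a b).
Proof.
move=> ab x; apply/cvgrPdist_lt => e e0; near=> y.
have xy : `|x - y| < e by near: y; exact: cvgr_dist_lt.
apply: le_lt_trans xy; have [xy|/ltW yx] := leP x y.
  rewrite !ler0_norm ?subr_le0 ?clamp_nd// !opprB; exact: clamp_lipschitz.
rewrite !ger0_norm ?subr_ge0 ?clamp_nd//; exact: clamp_lipschitz.
Unshelve. all: by end_near. Qed.

(** Composing with [clamp] extends a function to the line by constants, so that
    Stieltjes measures can be formed from it. *)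
Lemma continuous_clamp (R : realType) (a b : R) (g : R -> R) : a <= b ->
  {within `[a, b], continuous g} -> continuous (g \o clamp a b).
Proof.
move=> ab /subspace_continuousP cg x.
have cab y : `[a, b]%classic (clamp a b y) by rewrite /= in_itv/= clamp_itv.
apply: (cvg_comp _ _ _ (cg _ (cab x))) => P /= wP.
have h : nbhs (x : R) (clamp a b @^-1` [set y | `[a, b]%classic y -> P y]).
  exact: (clamp_continuous ab wP).
apply: filterS h => y Hy.
exact: (Hy (cab y)).
Qed.

Lemma real_abs_continuous_within (R : realType) (a b : R) (f : R -> R) :
  real_abs_continuous a b f -> {within `[a, b], continuous f}.
Proof.
move=> fac; apply/subspace_continuousP => x; rewrite /= in_itv/= => /andP[ax xb].
apply/cvgrPdist_lt => e e0; have [d d0 H] := fac e e0.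
have H1 y z : a <= y -> y <= z -> z <= b -> z - y < d -> `|f z - f y| < e.
  move=> ay yz zb yzd; have := H 1%N (fun=> y) (fun=> z); rewrite !big_ord1; apply => //.
  by apply/trivIsetP => i j _ _; rewrite !ord1 eqxx.
have xd : \forall y \near within `[a, b]%classic (nbhs (x : R)), `|x - y| < d.
  by apply: filterS (nbhsx_ballx x _ d0) => y.
near=> y; have yab : a <= y <= b by near: y; exact: withinT.
have xy : `|x - y| < d by near: y; exact: xd.
case/andP: yab => ay yb; have [xley|/ltW ylex] := leP x y.
  by rewrite distrC; apply: H1 => //; rewrite (le_lt_trans (ler_norm _))// distrC.
by apply: H1 => //; rewrite (le_lt_trans (ler_norm _)).
Unshelve. all: by end_near. Qed.

(** Write [f] as a difference [V - W] of nondecreasing continuous functions, [V]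
    being the total variation, and take the difference of their Stieltjes
    measures.  On a null set [N] this charge is small: approximate [N] by finitely
    many disjoint intervals for Lebesgue measure, [V] and [W] at the same time; they
    have small total length, so absolute continuity makes the sum of the
    increments of [f] over them small. *)
Lemma abs_continuous_charge (R : realType) (a b : R) (f : R -> R) :
  a < b -> real_abs_continuous a b f ->
  exists nu : {charge set (measurableTypeR R) -> \bar R},
    nu `<< @lebesgue_measure R /\
    forall x, a <= x <= b -> nu `]a, x]%classic = (f x - f a)%:E.
Proof.
move=> ab fac; have leab := ltW ab.
have bvf := abs_continuous_bounded_variation leab fac.
have cf := real_abs_continuous_within fac.
pose c := clamp a b; pose fc := f \o c.
have cfc : continuous fc by exact: continuous_clamp.
pose V := (fine \o total_variation a ^~ f) \o c.
have cV : continuous V by apply: continuous_clamp => //; exact: total_variation_continuous.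
have Vinc x y : x <= y -> `|fc y - fc x| <= V y - V x.
  move=> xy; have /andP[acx cxb] := clamp_itv x leab.
  have /andP[acy cyb] := clamp_itv y leab.
  have cxy : c x <= c y := clamp_nd a b xy.
  have fin z : a <= z -> z <= b -> total_variation a z f \is a fin_num.
    by move=> az zb; apply/bounded_variationP => //; exact: bounded_variationl bvf.
  rewrite -lee_fin /V /= -fineB ?fin// fineK; last by rewrite fin_numB !fin.
  rewrite (total_variationD f acx cxy) addeAC subee ?fin// add0e.
  exact: total_variation_ge.
have Vnd : nondecreasing V.
  by move=> x y /Vinc h; rewrite -subr_ge0; exact: le_trans h.
(* V increases at least as fast as f varies, so V - f is nondecreasing too. *)
pose W x := V x - fc x.
have Wnd : nondecreasing W.
  move=> x y /Vinc h; rewrite /W; have := le_trans (ler_norm _) h; lra.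
have cW : continuous W by move=> x; apply: cvgB; [exact: cV|exact: cfc].
(* M dominates Lebesgue measure, V and W, so a set that is small for M is small for
   all three. *)
pose M x := x + (V x + W x).
have Mnd : nondecreasing M.
  by move=> x y xy; apply: lerD => //; apply: lerD; [exact: Vnd|exact: Wnd].
have cM : continuous M.
  by move=> x; apply: cvgD => //; apply: cvgD; [exact: cV|exact: cW].
pose VC : cumulative R R := HB.pack V
  (isCumulative.Build R _ R V Vnd (right_continuousW cV)).
pose WC : cumulative R R := HB.pack W
  (isCumulative.Build R _ R W Wnd (right_continuousW cW)).
pose MC : cumulative R R := HB.pack M
  (isCumulative.Build R _ R M Mnd (right_continuousW cM)).
pose D : set (measurableTypeR R) := `]a, b]%classic.
have mD : measurable D by exact: measurable_itv.
pose lam := @lebesgue_measure R.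
pose muV := lebesgue_stieltjes_measure VC.
pose muW := lebesgue_stieltjes_measure WC.
pose muM := lebesgue_stieltjes_measure MC.
have lamitv x y : x <= y -> lam `]x, y]%classic = (y - x)%:E.
  exact: (@lebesgue_stieltjes_measure_itv _ idfun).
have Vitv x y : x <= y -> muV `]x, y]%classic = (V y - V x)%:E.
  exact: (@lebesgue_stieltjes_measure_itv _ VC).
have Witv x y : x <= y -> muW `]x, y]%classic = (W y - W x)%:E.
  exact: (@lebesgue_stieltjes_measure_itv _ WC).
have Mitv x y : x <= y -> muM `]x, y]%classic = (M y - M x)%:E.
  exact: (@lebesgue_stieltjes_measure_itv _ MC).
have ME (A : set (measurableTypeR R)) : measurable A ->
    muM A = (lam A + (muV A + muW A))%E.
  move=> mA; rewrite -(measure_addE muV muW) -measure_addE.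
  apply: (@lebesgue_stieltjes_measure_unique R MC
    (measure_add (@lebesgue_measure R) (measure_add muV muW))) => // _ [[x y] _ <-] /=.
  transitivity (lam `]x, y]%classic + (muV `]x, y]%classic + muW `]x, y]%classic))%E.
    rewrite -[lebesgue_stieltjes_measure _]/muM; have [xy|yx] := leP x y.
      by rewrite Mitv// lamitv// Vitv// Witv// -!EFinD /M; congr EFin; ring.
    have m0 (F : cumulative R R) : lebesgue_stieltjes_measure F set0 = 0%E.
      exact: measure0.
    rewrite set_itv_ge; last by rewrite bnd_simp -leNgt ltW.
    by rewrite /muM /muV /muW /lam /lebesgue_measure !m0 !adde0.
  by rewrite -(measure_addE muV muW) -measure_addE.
have VD : (muV D < +oo)%E by rewrite Vitv// ltry.
have WD : (muW D < +oo)%E by rewrite Witv// ltry.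
pose nu : {charge set (measurableTypeR R) -> \bar R} :=
  cadd (charge_of_finite_measure (mfrestr mD VD))
       (cscale (-1) (charge_of_finite_measure (mfrestr mD WD))).
have nuE A : nu A = (muV (A `&` D) - muW (A `&` D))%E.
  by transitivity (muV (A `&` D) + (-1)%:E * muW (A `&` D))%E; [|rewrite mulN1e].
exists nu; split; last first.
  move=> x /andP[ax xb]; rewrite nuE setIidl; last first.
    by apply: subset_itvl; rewrite bnd_simp.
  rewrite Vitv// Witv// -EFinB /W /fc /= !/c !clamp_id ?lexx ?ax ?leab//.
  by congr EFin; ring.
apply/null_content_dominatesP => N mN N0.
pose N' := N `&` D.
have mN' : measurable N' by exact: measurableI.
have N'0 : lam N' = 0%E.
  by apply: subset_measure0 N0 => //; exact: subIsetl.
suff H (e : R) : 0 < e -> (`|nu N| <= e%:E)%E.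
  apply/eqP; rewrite -abse_eq0 eq_le abse_ge0 andbT.
  by apply/lee_addgt0Pr => e e0; rewrite add0e; exact: H.
move=> e0.
have [d d0 H] := fac (e / 2) (divr_gt0 e0 (ltr0n _ 2)).
(* Half of e is for the increments of f over the approximating intervals; e / 8 is
   for each of the four differences p, q, p', q' between these intervals and N.
   The bound d / 2 keeps the total length of the intervals below d. *)
pose eta := Num.min (e / 8) (d / 2).
have eta0 : 0 < eta by rewrite lt_min !divr_gt0.
have N'oo : (muM N' < +oo)%E.
  apply: (@le_lt_trans _ _ (muM D)); last by rewrite Mitv// ltry.
  by apply: le_measure; rewrite ?inE//; exact: subIsetr.
have [m [s [t [st tst NB BN]]]] := lebesgue_stieltjes_measure_approx mN' N'oo eta0.
set B := \bigcup_i _ in NB BN.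
have mI i : measurable (`]s i, t i]%classic : set (measurableTypeR R)).
  exact: measurable_itv.
have mB : measurable (B : set (measurableTypeR R)) by exact: fin_bigcup_measurable.
have sumE (F : cumulative R R) :
    lebesgue_stieltjes_measure F B = (\sum_(i < m) (F (t i) - F (s i)))%:E.
  have BE : B = \big[setU/set0]_(i < m) `]s i, t i]%classic.
    by rewrite -bigcup_pred; apply/seteqP; split => x [i _ ?]; exists i.
  rewrite BE measure_semi_additive_ord//=; last by rewrite -BE.
  rewrite -sumEFin; apply: eq_bigr => i _.
  exact: lebesgue_stieltjes_measure_itv.
have dom (mu : {measure set (measurableTypeR R) -> \bar R}) A :
    (forall A, measurable A -> mu A <= muM A)%E -> measurable A ->
    (muM A <= eta%:E)%E -> exists r, [/\ mu A = r%:E, 0 <= r & r <= eta].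
  move=> mule mA Ae; have mA' := le_trans (mule _ mA) Ae.
  have fA : mu A \is a fin_num by rewrite ge0_fin_numE// (le_lt_trans mA')// ltry.
  exists (fine (mu A)); rewrite fineK// fine_ge0//; split => //.
  by rewrite -lee_fin fineK.
have lamM A : measurable A -> (lam A <= muM A)%E.
  by move=> mA; rewrite ME// leeDl// adde_ge0// measure_ge0.
have VM A : measurable A -> (muV A <= muM A)%E.
  by move=> mA; rewrite ME// addeCA leeDl// adde_ge0// measure_ge0.
have WM A : measurable A -> (muW A <= muM A)%E.
  by move=> mA; rewrite ME// addeA leeDr// adde_ge0// measure_ge0.
have mNB : measurable (N' `\` B) by exact: measurableD.
have mBN : measurable (B `\` N') by exact: measurableD.
have [p [pE p0 pe]] := dom _ _ VM mNB NB.
have [q [qE q0 qe]] := dom _ _ VM mBN BN.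
have [p' [p'E p'0 p'e]] := dom _ _ WM mNB NB.
have [q' [q'E q'0 q'e]] := dom _ _ WM mBN BN.
have Bd : \sum_(i < m) (t i - s i) < d.
  rewrite -lte_fin -(sumE idfun) -[lebesgue_stieltjes_measure _ _]/(lam B).
  have -> : lam B = (lam (B `\` N') + lam (B `&` N'))%E.
    exact: (@measureDI _ _ _ (@lebesgue_measure R)).
  have -> : lam (B `&` N') = 0%E.
    by apply: subset_measure0 N'0 => //; exact: measurableI.
  rewrite adde0; apply: (le_lt_trans (lamM _ mBN)); apply: (le_lt_trans BN).
  rewrite lte_fin /eta gt_min; apply/orP; right; lra.
have fB : `|\sum_(i < m) (fc (t i) - fc (s i))| < e / 2.
  apply: le_lt_trans (ler_norm_sum _ _ _) _; apply: (H m (c \o s) (c \o t)).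
  - move=> i /=; have /andP[? _] := clamp_itv (s i) leab.
    by have /andP[_ ?] := clamp_itv (t i) leab; split => //; split => //; exact: clamp_nd.
  - move=> i j _ _ /= [x []]; rewrite /= !in_itv/= => /andP[si ti] /andP[sj tj].
    have sub y z : c y < x -> x < c z -> y < x /\ x <= z.
      rewrite /c /clamp gt_max gt_min lt_max lt_min => /andP[ax] /orP[yx|bx].
        by case/orP=> [xa|/andP[/ltW]//]; move: (lt_trans xa ax); rewrite ltxx.
      by case/orP=> [xa|/andP[_ xb]];
        [move: (lt_trans xa ax)|move: (lt_trans xb bx)]; rewrite ltxx.
    have [? ?] := sub _ _ si ti; have [? ?] := sub _ _ sj tj.
    by apply: tst => //; exists x; split; rewrite /= in_itv/=; apply/andP.
  - apply: le_lt_trans Bd; apply: ler_sum => i _; exact: clamp_lipschitz.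
have VB := sumE VC; have WB := sumE WC.
have VBN : muV B = (muV (B `\` N') + muV (B `&` N'))%E.
  exact: (@measureDI _ _ _ (lebesgue_stieltjes_measure VC)).
have WBN : muW B = (muW (B `\` N') + muW (B `&` N'))%E.
  exact: (@measureDI _ _ _ (lebesgue_stieltjes_measure WC)).
have VN : muV N' = (muV (N' `\` B) + muV (N' `&` B))%E.
  exact: (@measureDI _ _ _ (lebesgue_stieltjes_measure VC)).
have WN : muW N' = (muW (N' `\` B) + muW (N' `&` B))%E.
  exact: (@measureDI _ _ _ (lebesgue_stieltjes_measure WC)).
rewrite [muV B]VB [muV (B `\` _)]qE in VBN; rewrite [muW B]WB [muW (B `\` _)]q'E in WBN.
rewrite [muV (_ `\` _)]pE setIC in VN; rewrite [muW (_ `\` _)]p'E setIC in WN.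
have [u uE] : exists u, muV (B `&` N') = u%:E.
  by move: VBN; case: (muV (B `&` N')) => [u| |]//=; exists u.
have [v vE] : exists v, muW (B `&` N') = v%:E.
  by move: WBN; case: (muW (B `&` N')) => [v| |]//=; exists v.
rewrite nuE VN WN uE vE -!EFinD /= lee_fin.
move: VBN WBN; rewrite uE vE -!EFinD => -[VBN] [WBN].
have fWV : \sum_(i < m) (fc (t i) - fc (s i)) =
    \sum_(i < m) (V (t i) - V (s i)) - \sum_(i < m) (W (t i) - W (s i)).
  by rewrite -sumrB; apply: eq_bigr => i _; rewrite /W; ring.
have eta8 : eta <= e / 8 by rewrite ge_min lexx.
move: fB; rewrite fWV VBN WBN ltr_norml ler_norml => /andP[? ?].
apply/andP; split; lra.
Qed.

Lemma abs_continuous_integral (R : realType) (a b : R) (f : R -> R) :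
  a < b -> real_abs_continuous a b f ->
  exists2 h : R -> R, (@lebesgue_measure R).-integrable setT (EFin \o h) &
    forall x, a <= x <= b ->
      f x - f a = \int[@lebesgue_measure R]_(y in `[a, x]) h y.
Proof.
move=> ab fac; have [nu [dnu nuE]] := abs_continuous_charge ab fac.
pose F := Radon_Nikodym nu (@lebesgue_measure R).
pose h := fine \o F.
have hF : EFin \o h = F.
  by apply/funext => x; rewrite /h /= fineK//; exact: Radon_Nikodym_fin_num.
have ih : (@lebesgue_measure R).-integrable setT (EFin \o h).
  by rewrite hF; exact: Radon_Nikodym_integrable.
exists h => // x axb; rewrite -Rintegral_itv_obnd_cbnd; last first.
  exact: integrableS ih.
have := nuE x axb; rewrite (Radon_Nikodym_integral dnu); last exact: measurable_itv.
by rewrite -/F -hF /Rintegral /= => ->.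
Qed.

(** Lebesgue differentiation, in the form of [is_derive]. *)
Lemma integral_is_derive_ae (R : realType) (a : R) (h : R -> R) :
  (@lebesgue_measure R).-integrable setT (EFin \o h) ->
  {ae @lebesgue_measure R, forall x : R, a < x ->
    is_derive x 1 (fun y => \int[@lebesgue_measure R]_(z in `[a, y]) h z) (h x)}.
Proof.
move=> ih.
have ihS (A : set R) : measurable A -> (@lebesgue_measure R).-integrable A (EFin \o h).
  by move=> mA; exact: integrableS ih.
have lh : locally_integrable [set: R] h by exact: (open_integrable_locally openT ih).
have := @FTC1 R h (BLeft a) (fun y => ihS _ (measurable_itv _)) lh.
apply: filterS; first exact: (ae_filter_ringOfSetsType (@lebesgue_measure R)).
move=> x /= Fx ax; have [|dF F'] := Fx; first by rewrite lte_fin.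
by split; [exact: dF|rewrite -derive1E].
Qed.

Lemma abs_continuous_FTC (R : realType) (a b : R) (f : R -> R) :
  a < b -> real_abs_continuous a b f ->
  exists h : R -> R, [/\ (@lebesgue_measure R).-integrable setT (EFin \o h),
    forall x y, a <= x -> x <= y -> y <= b ->
      f y - f x = \int[@lebesgue_measure R]_(z in `[x, y]) h z &
    {ae @lebesgue_measure R, forall x, `]a, b[%classic x -> is_derive x 1 f (h x)}].
Proof.
move=> ab fac; have [h ih hE] := abs_continuous_integral ab fac.
have ihS (A : set R) : measurable A -> (@lebesgue_measure R).-integrable A (EFin \o h).
  by move=> mA; exact: integrableS ih.
exists h; split => //.
  move=> x y ax xy yb; have ay := le_trans ax xy; have xb := le_trans xy yb.
  rewrite -(Rintegral_itv_obnd_cbnd (ihS _ _))//.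
  rewrite -(Rintegral_itvB (a := BLeft a) (ihS _ _))// -!hE ?ax ?ay//; ring.
pose F x := \int[@lebesgue_measure R]_(y in `[a, x]) h y.
have := @integral_is_derive_ae R a h ih.
apply: filterS; first exact: (ae_filter_ringOfSetsType (@lebesgue_measure R)).
move=> x /= isF0; rewrite in_itv/= => /andP[ax xb]; have {}isF0 := isF0 ax.
have near_f : {near x, F + cst (f a) =1 f}.
  near=> y; rewrite /= !fctE /F -hE ?subrK//.
  apply/andP; split; near: y; [exact: lt_le_nbhsr|exact: lt_le_nbhsl].
have isF : is_derive x 1 (F + cst (f a)) (h x).
  by rewrite -[h x]addr0; apply: is_deriveD.
by apply: near_eq_is_derive near_f isF; rewrite oner_neq0.
Unshelve. all: by end_near. Qed.

Lemma integral_abs_continuous (R : realType) (a b : R) (h : R -> R) :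
  (@lebesgue_measure R).-integrable setT (EFin \o h) ->
  real_abs_continuous a b (fun y => \int[@lebesgue_measure R]_(z in `[a, y]) h z).
Proof.
move=> ih e e0; have [d [d0 H]] := integral_normr_continuous ih e0.
have ihS (A : set R) : measurable A -> (@lebesgue_measure R).-integrable A (EFin \o h).
  by move=> mA; exact: integrableS ih.
exists d => // n s t st tst std.
pose F i : set (measurableTypeR R) := `]s i, t i[%classic.
have mF i : measurable (F i) by exact: measurable_itv.
pose U := \big[setU/set0]_(i < n) F i.
have mU : measurable U by apply: bigsetU_measurable => i _; exact: mF.
apply: le_lt_trans (H U mU _); last first.
  rewrite measure_semi_additive_ord// -/(F _) (eq_bigr (fun i => (t i - s i)%:E)).
    by rewrite sumEFin lte_fin.
  move=> i _; have [_ [sti _]] := st i.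
  transitivity (lebesgue_measure `]s i, t i[%classic) => //.
  rewrite lebesgue_measure_itv /= lte_fin.
  case: ifPn => [_|]; first by rewrite -EFinD.
  by rewrite -leNgt => tsi; rewrite (_ : t i = s i) ?subrr//; apply/le_anti/andP.
rewrite /Rintegral integral_bigsetU_EFin//; last 3 first.
- by rewrite /index_enum -enumT enum_uniq.
- by move=> i j _ _; exact: tst.
- apply: measurable_funS measurableT _ _ => //.
  have /measurable_int/measurable_EFinP mh := ih.
  by apply/measurable_EFinP; exact: measurableT_comp mh.
have fin i : (\int[@lebesgue_measure R]_(x in F i) (`|h x|%R)%:E)%E \is a fin_num.
  have /integrable_abse/integrable_fin_num := ihS _ (mF i); exact.
rewrite -[leRHS]/(fine _) -(eq_bigr _ (fun i _ => fineK (fin i))) sumEFin /=.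
apply: ler_sum => i _; have [asi [sti _]] := st i.
rewrite (Rintegral_itvB (a := BLeft a) (ihS _ _)) ?bnd_simp//.
have -> : \int[@lebesgue_measure R]_(x in [set` Interval (BRight (s i)) (BRight (t i))]) h x =
          \int[@lebesgue_measure R]_(x in F i) h x.
  by rewrite -Rintegral_itv_bndo_bndc//; exact: ihS.
exact: (le_normr_Rintegral (mF i) (ihS _ (mF i))).
Qed.

(** * Integrals of functions equal almost everywhere to a measurable one *)

Import HBNNSimple.

(** The integral of a nonnegative function is a supremum over the simple functions
    below it, which makes sense without measurability of [f].  A simple function
    below [f] is almost everywhere below [g], and [g] cut off on the null set is
    below [f]. *)
Lemma ge0_ae_eq_integral_measr d (T : measurableType d) (R : realType)
    (mu : {measure set T -> \bar R}) (f g : T -> \bar R) :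
  (forall x, 0 <= f x)%E -> (forall x, 0 <= g x)%E -> measurable_fun setT g ->
  ae_eq mu setT f g -> (\int[mu]_x f x = \int[mu]_x g x)%E.
Proof.
move=> f0 g0 mg [N [mN N0 fgN]].
have fg x : ~ N x -> f x = g x.
  by move=> Nx; apply: contrapT => fgx; apply: Nx; apply: fgN => /= h; exact/fgx/h.
apply/eqP; rewrite eq_le; apply/andP; split.
- rewrite ge0_integralTE//; apply: ge_ereal_sup => _ /= [phi phif <-].
  rewrite -integralT_nnsfun; apply: ae_ge0_le_integral => //.
  + by move=> x _; rewrite lee_fin; exact: fun_ge0.
  + exact/measurable_EFinP.
  + exists N; split => // x /= h; apply: contrapT => Nx.
    by apply: h => _; rewrite -fg.
- have mgN : measurable_fun setT (g \_ (~` N)).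
    by apply/(measurable_restrictT _ (measurableC mN)); exact: measurable_funS mg.
  have -> : (\int[mu]_x g x = \int[mu]_x (g \_ (~` N)) x)%E.
    apply: ge0_ae_eq_integral => //.
      by move=> x _; rewrite patchE; case: ifP.
    exists N; split => // x /= h; apply: contrapT => Nx; apply: h => _.
    by rewrite patchE mem_set.
  rewrite !ge0_integralTE//; last by move=> x; rewrite patchE; case: ifP.
  apply: ge_ereal_sup => _ [phi phig <-]; apply: ereal_sup_ubound; exists phi => // x.
  apply: (le_trans (phig x)); rewrite patchE; case: ifPn => // /set_mem Nx.
  by rewrite fg.
Qed.

Lemma ae_eq_integral_measr d (T : measurableType d) (R : realType)
    (mu : {measure set T -> \bar R}) (D : set T) (f g : T -> \bar R) :
  measurable D -> measurable_fun D g ->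
  ae_eq mu D f g -> (\int[mu]_(x in D) f x = \int[mu]_(x in D) g x)%E.
Proof.
move=> mD mg fg; rewrite integral_mkcond [RHS]integral_mkcond.
have mgD : measurable_fun setT (g \_ D) by apply/(measurable_restrictT _ mD).
have fgD : ae_eq mu setT (f \_ D) (g \_ D).
  by apply: filterS fg => x fgx _; rewrite !patchE; case: ifPn => // /set_mem /fgx.
have /ae_eq_funeposneg[fgp fgn] := fgD.
rewrite integralE [RHS]integralE; congr (_ - _)%E.
- by apply: ge0_ae_eq_integral_measr => //; exact: measurable_funepos.
- by apply: ge0_ae_eq_integral_measr => //; exact: measurable_funeneg.
Qed.

Lemma ae_eq_Rintegral_measr d (T : measurableType d) (R : realType)
    (mu : {measure set T -> \bar R}) (D : set T) (f g : T -> R) :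
  measurable D -> measurable_fun D g ->
  {ae mu, forall x, D x -> f x = g x} -> \int[mu]_(x in D) f x = \int[mu]_(x in D) g x.
Proof.
move=> mD mg fg; rewrite /Rintegral; congr fine; apply: ae_eq_integral_measr => //.
  exact/measurable_EFinP.
by apply: filterS fg => x fgx /fgx ->.
Qed.

(** * Derivatives of curves in W^{1,1} *)

Lemma enorm_ge0 (R : realType) (x : 'rV[R]_2) : 0 <= enorm x.
Proof. exact: sqrtr_ge0. Qed.

Lemma ler_coord_enorm (R : realType) (x : 'rV[R]_2) (i : 'I_2) : `|x 0 i| <= enorm x.
Proof.
rewrite -sqrtr_sqr ler_sqrt ?sumr_ge0// => [|j _]; last exact: sqr_ge0.
by rewrite (bigD1 i)//= lerDl sumr_ge0// => j _; exact: sqr_ge0.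
Qed.

Lemma enorm_le_sum (R : realType) (x : 'rV[R]_2) : enorm x <= \sum_(i < 2) `|x 0 i|.
Proof.
have s0 : 0 <= \sum_(i < 2) `|x 0 i| by exact: sumr_ge0.
rewrite -[leRHS](ger0_norm s0) -sqrtr_sqr ler_sqrt ?sqr_ge0//.
rewrite !big_ord_recl !big_ord0 !addr0 -[x 0 0 ^+ 2]real_normK ?num_real//.
rewrite -[X in _ + X <= _]real_normK ?num_real// sqrrD lerD2r lerDl.
by rewrite mulrn_wge0// mulr_ge0.
Qed.

(** A Borel version, integrable on the whole line, of the almost everywhere
    derivative of [g] on the unit interval. *)
Definition W11_derivative (R : realType) (g h : R -> 'rV[R]_2) : Prop :=
  [/\ forall i, (@lebesgue_measure R).-integrable setT (EFin \o (fun u => h u 0 i)),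
    forall i x y, 0 <= x -> x <= y -> y <= 1 ->
      g y 0 i - g x 0 i = \int[@lebesgue_measure R]_(u in `[x, y]) h u 0 i &
    {ae @lebesgue_measure R, forall u : R, `]0, 1[%classic u -> is_derive u 1 g (h u)}].

(** Makes [filterS] and its variants available for Lebesgue measure, whose
    sigma-algebra is the one generated by the half-open intervals. *)
#[local] Instance ae_lebesgue_filter (R : realType) :
  Filter (almost_everywhere (@lebesgue_measure R)).
Proof. exact: (ae_filter_ringOfSetsType (@lebesgue_measure R)). Qed.

Lemma ae_itv_oo_cc (R : realType) (a b : R) (P : R -> Prop) :
  {ae @lebesgue_measure R, forall u, `]a, b[%classic u -> P u} ->
  {ae @lebesgue_measure R, forall u, `[a, b]%classic u -> P u}.
Proof.
move=> h.
have hx (x : R) : {ae @lebesgue_measure R, forall u, u != x}.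
  exists [set x]; split; [exact: measurable_set1|exact: lebesgue_measure_set1|].
  by move=> u /= /negP; rewrite negbK => /eqP.
have ha := hx a; have hb := hx b.
apply: filterS3 h ha hb => u Pu ua ub; rewrite /= in_itv/= => /andP[au ub'].
by apply: Pu; rewrite /= in_itv/= !lt_neqAle au ub' ub eq_sym ua.
Qed.

Lemma W11_has_derivative (R : realType) (g : R -> 'rV[R]_2) :
  W11 R g -> exists h, W11_derivative g h.
Proof.
move=> [gac _].
have gi (i : 'I_2) : real_abs_continuous 0 1 (fun u => g u 0 i).
  move=> e e0; have [d d0 H] := gac e e0; exists d => // n s t st tst std.
  apply: le_lt_trans (H n s t st tst std); apply: ler_sum => j _.
  by have := ler_coord_enorm (g (t j) - g (s j)) i; rewrite !mxE.
have [h hP] := choice (fun i => abs_continuous_FTC ltr01 (gi i)).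
exists (fun u => \row_i h i u); split.
- move=> i; have [ih _ _] := hP i.
  by rewrite (_ : _ \o _ = EFin \o h i)//; apply/funext => u /=; rewrite mxE.
- move=> i x y x0 xy y1; have [_ -> // _] := hP i.
  by apply: eq_Rintegral => u _; rewrite mxE.
- have [_ _ h0] := hP 0; have [_ _ h1] := hP 1.
  apply: filterS2 h0 h1 => u h0 h1 u01; have {}h0 := h0 u01; have {}h1 := h1 u01.
  have hi (i : 'I_2) : is_derive u 1 (fun v => g v 0 i) (h i u).
    have [->//|->//] : i = 0 \/ i = 1.
      by case: i => -[|[|//]] i2; [left|right]; exact: val_inj.
  have dg : derivable g u 1.
    by apply/derivable_mxP => i j; rewrite ord1; have [] := hi j.
  split => //; rewrite derive_mx//; apply/rowP => j; rewrite !mxE.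
  by have [_ <-] := hi j.
Qed.

Lemma measurable_enorm (R : realType) (h : R -> 'rV[R]_2) :
  (forall i, measurable_fun setT (fun u => h u 0 i)) ->
  measurable_fun setT (fun u => enorm (h u)).
Proof.
move=> mh; rewrite /enorm; apply: measurableT_comp => //.
  exact: (continuous_measurable_fun (@sqrt_continuous R)).
by apply: measurable_sum => i; apply: measurable_funX.
Qed.

Lemma integrable_enorm (R : realType) (h : R -> 'rV[R]_2) :
  (forall i, (@lebesgue_measure R).-integrable setT (EFin \o (fun u => h u 0 i))) ->
  (@lebesgue_measure R).-integrable setT (EFin \o (fun u => enorm (h u))).
Proof.
move=> ih.
have : (@lebesgue_measure R).-integrable setT (fun u => (\sum_(i < 2) `|h u 0 i|%:E)%E).
  by apply: integrable_sum => // i _; exact: (integrable_abse (ih i)).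
apply: le_integrable => //.
- apply/measurable_EFinP; apply: measurable_enorm => i.
  by have /measurable_int/measurable_EFinP := ih i.
- move=> u _ /=; rewrite sumEFin !gee0_abs ?lee_fin ?enorm_ge0 ?sumr_ge0//.
  by rewrite ger0_norm ?enorm_ge0// enorm_le_sum.
Qed.

Definition speed (R : realType) (h : R -> 'rV[R]_2) (u : R) : R := enorm (h u).

Section speed.
Variables (R : realType) (g h : R -> 'rV[R]_2).
Hypothesis gh : W11_derivative g h.
Local Notation mu := (@lebesgue_measure R).

Lemma W11_derivative_ae : {ae mu, forall u : R, `[0, 1]%classic u -> derive1 g u = h u}.
Proof.
have [_ _ dgh] := gh; apply: ae_itv_oo_cc; apply: filterS dgh => u dg u01.
by rewrite derive1E; have [_ ->] := dg u01.
Qed.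

Lemma measurable_speed : measurable_fun setT (speed h).
Proof.
by apply: measurable_enorm => i; have [/(_ i) /measurable_int/measurable_EFinP] := gh.
Qed.

Lemma integrable_speed (A : set R) : measurable A -> mu.-integrable A (EFin \o speed h).
Proof.
move=> mA; apply: (integrableS measurableT) => //.
by apply: integrable_enorm; have [] := gh.
Qed.

Lemma integral_speed (A : set R) : measurable A -> A `<=` `[0, 1]%classic ->
  \int[mu]_(u in A) enorm (derive1 g u) = \int[mu]_(u in A) speed h u.
Proof.
move=> mA A01; apply: ae_eq_Rintegral_measr => //.
  exact: measurable_funS measurable_speed.
by apply: filterS W11_derivative_ae => u dg Au; rewrite dg//; exact: A01.
Qed.

End speed.

(** * The Green function *)

Lemma is_derive_ge0 (R : realType) (f : R -> R) (a b x d : R) :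
  a < x < b -> (forall y z, a < y -> y <= z -> z < b -> f y <= f z) ->
  is_derive x 1 f d -> 0 <= d.
Proof.
move=> /andP[ax xb] ndf [df <-]; apply: limr_ge; first exact: df.
have ax' : a - x < 0 by rewrite subr_lt0.
have xb' : 0 < b - x by rewrite subr_gt0.
near=> k; have ka : a < k + x.
  by rewrite -ltrBlDr; near: k; apply: nbhs_dnbhs; exact: lt_nbhsr.
have kb : k + x < b.
  by rewrite -ltrBrDr; near: k; apply: nbhs_dnbhs; exact: lt_nbhsl.
rewrite /= -[k *: 1]/(k * 1) mulr1; have [k0|k0] := leP 0 k.
  by rewrite mulr_ge0 ?invr_ge0// subr_ge0 ndf// lerDr.
rewrite mulr_le0 ?invr_le0 ?(ltW k0)// subr_le0 ndf// gerDr ltW//.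
Unshelve. all: by end_near. Qed.

Lemma derive_lipschitz (R : realType) (f df : R -> R) (a b M : R) :
  (forall x : R, is_derive x 1 f (df x)) -> (forall x, a <= x <= b -> `|df x| <= M) ->
  forall x y, a <= x <= b -> a <= y <= b -> `|f y - f x| <= M * `|y - x|.
Proof.
move=> fdf dfM.
have H x y : a <= x -> x <= y -> y <= b -> `|f y - f x| <= M * `|y - x|.
  move=> ax xy yb.
  have cf : {within `[x, y], continuous f}.
    apply: continuous_subspaceT => z; apply: differentiable_continuous.
    by apply/derivable1_diffP; have [] := fdf z.
  have [c + ->] := MVT_segment xy (fun z _ => fdf z) cf.
  rewrite in_itv/= => /andP[xc cy]; rewrite normrM ler_wpM2r// dfM//.
  by rewrite (le_trans ax xc) (le_trans cy yb).
move=> x y /andP[ax xb] /andP[ay yb]; have [xy|/ltW yx] := leP x y; first exact: H.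
by rewrite distrC (distrC y); exact: H.
Qed.

(** The formula for the Green function on one period, as a smooth function on the
    whole line. *)
Definition green_cell (R : realType) (lam y : R) : R :=
  - (coshR ((y - 1 / 2) / lam) / (2 * lam * sinhR (1 / (2 * lam)))).

Definition green_cell_primitive (R : realType) (lam y : R) : R :=
  - (sinhR ((y - 1 / 2) / lam) / (2 * sinhR (1 / (2 * lam)))).

Lemma is_derive_expRN (R : realType) (x : R) : is_derive x 1 (fun x => expR (- x)) (- expR (- x)).
Proof.
have -> : - expR (- x) = expR (- x) * -1 by ring.
by apply: (@is_derive1_comp R expR -%R x).
Qed.

Lemma is_derive_sinhR (R : realType) (x : R) : is_derive x 1 (@sinhR R) (coshR x).
Proof.
have -> : @sinhR R = (fun x => (1 / 2) *: (expR x - expR (- x))).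
  by apply/funext => y; rewrite /sinhR /GRing.scale /=; ring.
have -> : coshR x = (1 / 2) *: (expR x - (- expR (- x))).
  by rewrite /coshR /GRing.scale /=; ring.
have := is_derive_expRN x => ?.
by apply: is_deriveZ; apply: is_deriveB.
Qed.

Lemma is_derive_coshR (R : realType) (x : R) : is_derive x 1 (@coshR R) (sinhR x).
Proof.
have -> : @coshR R = (fun x => (1 / 2) *: (expR x + expR (- x))).
  by apply/funext => y; rewrite /coshR /GRing.scale /=; ring.
have -> : sinhR x = (1 / 2) *: (expR x + (- expR (- x))).
  by rewrite /sinhR /GRing.scale /=; ring.
have := is_derive_expRN x => ?.
by apply: is_deriveZ; apply: is_deriveD.
Qed.

Lemma sinhR_gt0 (R : realType) (x : R) : 0 < x -> 0 < sinhR x.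
Proof. by move=> x0; rewrite /sinhR divr_gt0// subr_gt0 ltr_expR; lra. Qed.

Lemma is_derive_affine (R : realType) (lam x : R) :
  is_derive x 1 (fun y => (y - 1 / 2) / lam) lam^-1.
Proof.
have -> : (fun y : R => (y - 1 / 2) / lam) = (fun y => lam^-1 *: (y - 1 / 2)).
  by apply/funext => y; rewrite /GRing.scale /= mulrC.
have {2}-> : lam^-1 = lam^-1 *: (1 - 0) by rewrite subr0 /GRing.scale /= mulr1.
by apply: is_deriveZ; apply: is_deriveB.
Qed.

Lemma is_derive_green_cell_primitive (R : realType) (lam x : R) : 0 < lam ->
  is_derive x 1 (green_cell_primitive lam) (green_cell lam x).
Proof.
move=> lam0; pose k := - (2 * sinhR (1 / (2 * lam)))^-1.
have s0 : sinhR (1 / (2 * lam)) != 0 by rewrite gt_eqF// sinhR_gt0// divr_gt0// mulr_gt0.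
have -> : green_cell_primitive lam = (fun y => k *: ((@sinhR R) \o (fun y => (y - 1 / 2) / lam)) y).
  by apply/funext => y; rewrite /green_cell_primitive /k /GRing.scale /=; ring.
have -> : green_cell lam x = k *: (coshR ((x - 1 / 2) / lam) * lam^-1).
  rewrite /green_cell /k /GRing.scale /=; field; rewrite s0 ?gt_eqF//.
apply: is_deriveZ; apply: is_derive1_comp; [exact: is_derive_sinhR|exact: is_derive_affine].
Qed.

Lemma is_derive_green_cell (R : realType) (lam x : R) : 0 < lam ->
  is_derive x 1 (green_cell lam)
    (- (sinhR ((x - 1 / 2) / lam) / (2 * lam ^+ 2 * sinhR (1 / (2 * lam))))).
Proof.
move=> lam0; pose k := - (2 * lam * sinhR (1 / (2 * lam)))^-1.
have s0 : sinhR (1 / (2 * lam)) != 0 by rewrite gt_eqF// sinhR_gt0// divr_gt0// mulr_gt0.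
have -> : green_cell lam = (fun y => k *: ((@coshR R) \o (fun y => (y - 1 / 2) / lam)) y).
  by apply/funext => y; rewrite /green_cell /k /GRing.scale /=; ring.
have -> : - (sinhR ((x - 1 / 2) / lam) / (2 * lam ^+ 2 * sinhR (1 / (2 * lam)))) =
    k *: (sinhR ((x - 1 / 2) / lam) * lam^-1).
  rewrite /k /GRing.scale /=; field; rewrite s0 ?gt_eqF//.
apply: is_deriveZ; apply: is_derive1_comp; [exact: is_derive_coshR|exact: is_derive_affine].
Qed.

Lemma green_cell01 (R : realType) (lam : R) : green_cell lam 0 = green_cell lam 1.
Proof.
rewrite /green_cell (_ : (0 - 1 / 2) / lam = - ((1 - 1 / 2) / lam)).
  by rewrite /coshR opprK (addrC (expR (- _))).
lra.
Qed.

Lemma Green_frac (R : realType) (lam x : R) :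
  Green lam x = green_cell lam (x - (Num.floor x)%:~R).
Proof.
have /andP[xge _] := floor_itv x.
by rewrite /Green /green_cell /= ger0_norm// subr_ge0.
Qed.

Lemma Green_itv01 (R : realType) (lam x : R) : 0 <= x <= 1 -> Green lam x = green_cell lam x.
Proof.
move=> /andP[x0]; rewrite le_eqVlt => /predU1P[->|x1]; rewrite Green_frac.
  by rewrite floor1 subrr green_cell01.
by rewrite (@floor_def _ x 0) ?subr0// add0r x0.
Qed.

Lemma Green_itvN10 (R : realType) (lam x : R) : -1 <= x <= 0 ->
  Green lam x = green_cell lam (x + 1).
Proof.
move=> /andP[x1]; rewrite le_eqVlt => /predU1P[->|x0]; rewrite Green_frac.
  by rewrite floor0 subr0 add0r green_cell01.
by rewrite (@floor_def _ x (-1)) ?opprK// x1 /= addNr.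
Qed.

Lemma normr_sinh_cosh_le (R : realType) (lam y : R) : 0 < lam -> 0 <= y <= 1 ->
  `|sinhR ((y - 1 / 2) / lam)| <= expR (1 / (2 * lam)) /\
  `|coshR ((y - 1 / 2) / lam)| <= expR (1 / (2 * lam)).
Proof.
move=> lam0 /andP[y0 y1]; set z := (y - 1 / 2) / lam.
have il0 : 0 < lam^-1 by rewrite invr_gt0.
have cE : 1 / (2 * lam) = (1 / 2) * lam^-1 by field; rewrite gt_eqF.
have z1 : z <= 1 / (2 * lam) by rewrite cE /z ler_pM2r//; lra.
have z2 : - z <= 1 / (2 * lam) by rewrite cE /z -mulNr ler_pM2r//; lra.
have e1 : expR z <= expR (1 / (2 * lam)) by rewrite ler_expR.
have e2 : expR (- z) <= expR (1 / (2 * lam)) by rewrite ler_expR.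
move: e1 e2 (expR_gt0 z) (expR_gt0 (- z)); rewrite /sinhR /coshR.
move: (expR z) (expR (- z)) (expR (1 / _)) => p q e e1 e2 p0 q0.
split; rewrite ler_norml; apply/andP; split; lra.
Qed.

Lemma green_cell_lipschitz (R : realType) (lam : R) : 0 < lam ->
  exists2 K, 0 <= K & forall x y, 0 <= x <= 1 -> 0 <= y <= 1 ->
    `|green_cell lam y - green_cell lam x| <= K * `|y - x|.
Proof.
move=> lam0; pose K := expR (1 / (2 * lam)) / (2 * lam ^+ 2 * sinhR (1 / (2 * lam))).
have s0 : 0 < 2 * lam ^+ 2 * sinhR (1 / (2 * lam)).
  apply: mulr_gt0; first by rewrite mulr_gt0// exprn_gt0.
  by rewrite sinhR_gt0// divr_gt0// mulr_gt0.
exists K; first by rewrite divr_ge0 ?expR_ge0// ltW.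
apply: (derive_lipschitz (fun x => is_derive_green_cell x lam0)) => x x01.
rewrite normrN normrM normfV (gtr0_norm s0) ler_pM2r ?invr_gt0//.
by have [] := normr_sinh_cosh_le lam0 x01.
Qed.

Lemma green_cell_primitive_lipschitz (R : realType) (lam : R) : 0 < lam ->
  exists2 K, 0 <= K & forall x y, 0 <= x <= 1 -> 0 <= y <= 1 ->
    `|green_cell_primitive lam y - green_cell_primitive lam x| <= K * `|y - x|.
Proof.
move=> lam0; pose K := expR (1 / (2 * lam)) / (2 * lam * sinhR (1 / (2 * lam))).
have s0 : 0 < 2 * lam * sinhR (1 / (2 * lam)).
  apply: mulr_gt0; first by rewrite mulr_gt0.
  by rewrite sinhR_gt0// divr_gt0// mulr_gt0.
exists K; first by rewrite divr_ge0 ?expR_ge0// ltW.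
apply: (derive_lipschitz (fun x => is_derive_green_cell_primitive x lam0)) => x x01.
rewrite normrN normrM normfV (gtr0_norm s0) ler_pM2r ?invr_gt0//.
by have [] := normr_sinh_cosh_le lam0 x01.
Qed.

(** The cell is Lipschitz on the unit interval and takes equal values at its ends,
    so its periodization is Lipschitz with the same constant. *)
Lemma Green_lipschitz (R : realType) (lam : R) : 0 < lam ->
  exists2 K, 0 <= K & forall x y, `|Green lam y - Green lam x| <= K * `|y - x|.
Proof.
move=> lam0; have [K K0 H] := green_cell_lipschitz lam0; exists K => //.
have {}H x y : x <= y -> `|Green lam y - Green lam x| <= K * (y - x).
  move=> xy; rewrite !Green_frac.
  have := floor_itv x; have := floor_itv y; have := le_floor xy.
  set m := Num.floor x; set n := Num.floor y; rewrite !intrD => mn /andP[n0 n1] /andP[m0 m1].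
  have fx : 0 <= x - m%:~R <= 1 by rewrite subr_ge0 m0 /=; lra.
  have fy : 0 <= y - n%:~R <= 1 by rewrite subr_ge0 n0 /=; lra.
  (* Points of different cells are compared through the ends of their cells, where
     the values agree; this only shortens the distance. *)
  have [mnE|mn'] := eqVneq m n.
    have := H _ _ fx fy; rewrite mnE.
    by rewrite (_ : y - _ - (x - _) = y - x) ?(@ger0_norm _ (y - x)) ?subr_ge0//; ring.
  have mn1 : m%:~R + 1 <= n%:~R :> R.
    by rewrite -[1]/(1%:~R) -intrD ler_int lezD1 lt_neqAle mn' mn.
  have i0 : 0 <= (0 : R) <= 1 by rewrite lexx ler01.
  have i1 : 0 <= (1 : R) <= 1 by rewrite lexx ler01.
  have h0 := H _ _ i0 fy; have h1 := H _ _ fx i1.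
  rewrite -[_ - _](subrKA (green_cell lam 0)) {2}green_cell01.
  apply: le_trans (ler_normD _ _) _; apply: le_trans (lerD h0 h1) _.
  rewrite -mulrDr ler_wpM2l// subr0 !ger0_norm; lra.
move=> x y; have [xy|/ltW yx] := leP x y.
  by rewrite (ger0_norm (_ : 0 <= y - x)) ?subr_ge0// H.
by rewrite distrC (distrC y) (ger0_norm (_ : 0 <= x - y)) ?subr_ge0// H.
Qed.

(** * Reparametrization by arclength *)

Lemma integrable_boundedM d (T : measurableType d) (R : realType)
    (mu : {measure set T -> \bar R}) (D : set T) (w q : T -> R) (M : R) :
  measurable D -> measurable_fun D w -> (forall v, D v -> `|w v| <= M) ->
  mu.-integrable D (EFin \o q) -> mu.-integrable D (EFin \o (fun v => w v * q v)).
Proof.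
move=> mD mw wM iq.
have iwq : mu.-integrable D ((EFin \o w) \* (EFin \o q))%E.
  apply: integrableMr => //; exists M; split => [|x Mx v Dv]; first exact: num_real.
  by apply: le_trans (ltW Mx); exact: wM.
by apply: eq_integrable iwq => // v _ /=; rewrite -EFinM.
Qed.

Lemma integrable_sub d (T : measurableType d) (R : realType)
    (mu : {measure set T -> \bar R}) (D : set T) (f g : T -> R) :
  measurable D -> mu.-integrable D (EFin \o f) -> mu.-integrable D (EFin \o g) ->
  mu.-integrable D (EFin \o (fun v => f v - g v)).
Proof.
move=> mD fi gi; have := integrableB mD fi gi.
by apply: eq_integrable => // v _ /=; rewrite EFinB.
Qed.

Lemma integrable_add d (T : measurableType d) (R : realType)
    (mu : {measure set T -> \bar R}) (D : set T) (f g : T -> R) :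
  measurable D -> mu.-integrable D (EFin \o f) -> mu.-integrable D (EFin \o g) ->
  mu.-integrable D (EFin \o (fun v => f v + g v)).
Proof.
move=> mD fi gi; have := integrableD mD fi gi.
by apply: eq_integrable => // v _ /=; rewrite EFinD.
Qed.

(** Both weights [G1 * q] and [G2 * q] have the same mass, so the difference of the
    two averages of [g] is unchanged when a constant [c] is subtracted from [g]. *)
Lemma weighted_integral_diff_le d (T : measurableType d) (R : realType)
    (mu : {measure set T -> \bar R}) (D : set T) (g G1 G2 q : T -> R) (c N M a b : R) :
  measurable D -> measurable_fun D g -> measurable_fun D G1 -> measurable_fun D G2 ->
  (forall v, D v -> `|g v| <= N) -> (forall v, D v -> `|G1 v| <= M) ->
  (forall v, D v -> `|G2 v| <= M) ->
  mu.-integrable D (EFin \o q) -> (forall v, D v -> 0 <= q v) ->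
  \int[mu]_(v in D) (G1 v * q v) = \int[mu]_(v in D) (G2 v * q v) ->
  (forall v, D v -> `|g v - c| <= a) -> (forall v, D v -> `|G1 v - G2 v| <= b) ->
  `|\int[mu]_(v in D) (g v * G1 v * q v) - \int[mu]_(v in D) (g v * G2 v * q v)|
    <= a * b * \int[mu]_(v in D) q v.
Proof.
move=> mD mg mG1 mG2 gN G1M G2M iq q0 G12 ga Gb.
have igG (G : T -> R) : measurable_fun D G -> (forall v, D v -> `|G v| <= M) ->
    mu.-integrable D (EFin \o (fun v => g v * G v * q v)).
  move=> mG GM; apply: (integrable_boundedM (M := N * M)) => //; first exact: measurable_funM.
  by move=> v Dv; rewrite normrM ler_pM// ?gN// GM.
have iG (G : T -> R) : measurable_fun D G -> (forall v, D v -> `|G v| <= M) ->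
    mu.-integrable D (EFin \o (fun v => G v * q v)).
  by move=> mG GM; apply: (integrable_boundedM (M := M)).
have icG (G : T -> R) : measurable_fun D G -> (forall v, D v -> `|G v| <= M) ->
    mu.-integrable D (EFin \o (fun v => c * (G v * q v))).
  move=> mG GM; apply: (integrable_boundedM (M := `|c|)) => //; exact: iG.
have ig1 := igG _ mG1 G1M; have ig2 := igG _ mG2 G2M.
have i1 := iG _ mG1 G1M; have i2 := iG _ mG2 G2M.
have ic1 := icG _ mG1 G1M; have ic2 := icG _ mG2 G2M.
pose X v := (g v - c) * (G1 v - G2 v) * q v.
have XE v : X v = g v * G1 v * q v - g v * G2 v * q v - (c * (G1 v * q v) - c * (G2 v * q v)).
  by rewrite /X; ring.
have iX : mu.-integrable D (EFin \o X).
  have : mu.-integrable D (EFin \o (fun v => g v * G1 v * q v - g v * G2 v * q v -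
      (c * (G1 v * q v) - c * (G2 v * q v)))).
    by apply: integrable_sub => //; exact: integrable_sub.
  by apply: eq_integrable => // v _ /=; rewrite XE.
have -> : \int[mu]_(v in D) (g v * G1 v * q v) - \int[mu]_(v in D) (g v * G2 v * q v) =
    \int[mu]_(v in D) X v.
  transitivity (\int[mu]_(v in D) (g v * G1 v * q v - g v * G2 v * q v -
      (c * (G1 v * q v) - c * (G2 v * q v)))); last first.
    by apply: eq_Rintegral => v _; rewrite XE.
  rewrite (RintegralB mD (integrable_sub mD ig1 ig2) (integrable_sub mD ic1 ic2)).
  rewrite (RintegralB mD ig1 ig2) (RintegralB mD ic1 ic2).
  by rewrite (RintegralZl _ mD i1) (RintegralZl _ mD i2) G12 subrr subr0.
apply: le_trans (le_normr_Rintegral mD iX) _.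
rewrite -RintegralZl//; apply: le_Rintegral => //.
- exact: (integrable_abse iX).
- have : mu.-integrable D (EFin \o (fun v => cst (a * b) v * q v)).
    by apply: (integrable_boundedM (M := `|a * b|)).
  exact.
- move=> v Dv; rewrite /X !normrM (ger0_norm (q0 _ Dv)) ler_wpM2r ?q0//.
  by rewrite ler_pM// ?ga ?Gb.
Qed.

Section arclength.
Variables (R : realType) (p : R -> R).
Local Notation mu := (@lebesgue_measure R).
Hypotheses (p0 : forall u, 0 <= p u) (ip : mu.-integrable setT (EFin \o p)).

Let ipS (A : set R) : measurable A -> mu.-integrable A (EFin \o p).
Proof. by move=> mA; exact: integrableS ip. Qed.

Definition arclength (x : R) : R := \int[mu]_(v in `[0, x]) p v.

Lemma arclengthB x y : 0 <= x -> x <= y ->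
  arclength y - arclength x = \int[mu]_(v in `[x, y]) p v.
Proof.
move=> x0 xy; rewrite /arclength (Rintegral_itvB (a := BLeft 0) (ipS _)) ?bnd_simp//.
by rewrite Rintegral_itv_obnd_cbnd//; exact: ipS.
Qed.

Lemma arclength_nd x y : 0 <= x -> x <= y -> arclength x <= arclength y.
Proof.
by move=> x0 xy; rewrite -subr_ge0 arclengthB//; apply: Rintegral_ge0 => v _.
Qed.

Lemma arclength0 : arclength 0 = 0.
Proof. by rewrite /arclength set_itv1 Rintegral_set1. Qed.

(** Change of variables along arclength, which is merely absolutely continuous and
    possibly constant on intervals.  The composite of the Lipschitz function [F]
    with it is absolutely continuous, hence the integral of its derivative, which
    the chain rule gives almost everywhere. *)
Lemma integral_comp_arclength (f F : R -> R) (c l s t K : R) : 0 < l -> 0 <= s -> s <= t ->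
  (forall x : R, is_derive x 1 F (f x)) ->
  (forall x y, 0 <= x <= 1 -> 0 <= y <= 1 -> `|F y - F x| <= K * `|y - x|) ->
  (forall v, s <= v <= t -> 0 <= l * arclength v + c <= 1) ->
  \int[mu]_(v in `[s, t]) (f (l * arclength v + c) * (l * p v)) =
    F (l * arclength t + c) - F (l * arclength s + c).
Proof.
move=> l0 s0; rewrite le_eqVlt => /predU1P[<-|st] dF FK rng.
  by rewrite set_itv1 Rintegral_set1 subrr.
pose H v := F (l * arclength v + c).
have K0 : 0 <= `|K| * l by rewrite mulr_ge0// ltW.
have Hac : real_abs_continuous s t H.
  move=> e e0; have e0' : 0 < e / (`|K| * l + 1) by rewrite divr_gt0// ltr_wpDl.
  have [d d0 Hd] := integral_abs_continuous 0 t ip e0'.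
  exists d => // n x y xy tr sd.
  have xy0 i : 0 <= x i /\ x i <= y i /\ y i <= t.
    by have [? [? ?]] := xy i; split => //; exact: le_trans s0 _.
  have {}Hd := Hd n x y xy0 tr sd.
  apply: (@le_lt_trans _ _ (\sum_(i < n) (`|K| * l + 1) * `|arclength (y i) - arclength (x i)|)).
    apply: ler_sum => i _; have [sx [xyi yt]] := xy i.
    have rx : s <= x i <= t by rewrite sx (le_trans xyi).
    have ry : s <= y i <= t by rewrite yt (le_trans sx).
    apply: le_trans (FK _ _ (rng _ rx) (rng _ ry)) _.
    rewrite (_ : _ - _ = l * (arclength (y i) - arclength (x i))); last by ring.
    rewrite normrM (gtr0_norm l0) mulrA ler_wpM2r//.
    by rewrite (le_trans (_ : _ <= `|K| * l)) ?ler_wpM2r ?(ltW l0) ?ler_norm// lerDl.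
  by rewrite -mulr_sumr mulrC -ltr_pdivlMr// ltr_wpDl.
have [h [ih hE dh]] := abs_continuous_FTC st Hac.
rewrite -/(H t) -/(H s) hE//; last exact: ltW.
apply: ae_eq_Rintegral_measr => //.
  have /measurable_int/measurable_EFinP mh := ih.
  exact: measurable_funS mh.
have dP := integral_is_derive_ae 0 ip.
apply: ae_itv_oo_cc; apply: filterS2 dh dP => v dHv dPv vst.
have {}dHv := dHv vst; move: vst; rewrite /= in_itv/= => /andP[sv vt].
have {}dPv := dPv (le_lt_trans s0 sv).
have dl : is_derive v 1 (fun u => l * arclength u + c) (l * p v).
  by rewrite -[l * p v]addr0; apply: is_deriveD; apply: is_deriveZ.
have [_ <-] := @is_derive1_comp R F (fun u => l * arclength u + c) v _ _ (dF _) dl.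
by have [_ <-] := dHv.
Qed.

Lemma measurable_arclength : measurable_fun (`[0%R, 1%R]%classic : set R) arclength.
Proof.
apply: subspace_continuous_measurable_fun => //.
exact: (real_abs_continuous_within (integral_abs_continuous 0 1 ip)).
Qed.

Lemma integrable_scaled_speed (l : R) : mu.-integrable `[0, 1] (EFin \o (fun v => l * p v)).
Proof. by apply: (integrable_boundedM (M := `|l|)) => //; exact: ipS. Qed.

Lemma integral_scaled_speed (l : R) :
  \int[mu]_(v in `[0, 1]) (l * p v) = l * arclength 1.
Proof. by rewrite RintegralZl//; exact: ipS. Qed.

Variables (lam l : R).
Hypotheses (lam0 : 0 < lam) (l0 : 0 < l) (lP1 : l * arclength 1 = 1).

Let lP_itv v : 0 <= v <= 1 -> 0 <= l * arclength v <= 1.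
Proof.
move=> /andP[v0 v1]; rewrite mulr_ge0 ?(ltW l0)//=; last by rewrite -arclength0 arclength_nd.
by rewrite -lP1 ler_pM2l// arclength_nd.
Qed.

Let Gu u v := Green lam (l * arclength v - l * arclength u).

Lemma measurable_Green_arclength (u : R) : measurable_fun (`[0%R, 1%R]%classic : set R) (Gu u).
Proof.
have cG : continuous (Green lam).
  have [K K0 GK] := Green_lipschitz lam0 => x; apply/cvgrPdist_lt => e e0.
  have e0' : 0 < e / (K + 1) by rewrite divr_gt0// ltr_wpDl.
  near=> y; rewrite distrC; apply: le_lt_trans (GK x y) _.
  apply: (@le_lt_trans _ _ ((K + 1) * `|y - x|)); first by rewrite ler_wpM2r// lerDl.
  rewrite mulrC -ltr_pdivlMr ?ltr_wpDl// distrC; near: y; exact: (nbhsx_ballx x).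
apply: (measurableT_comp (f := Green lam)); first exact: continuous_measurable_fun.
apply: measurable_funB; last exact: measurable_cst.
by apply: measurable_funM; [exact: measurable_cst|exact: measurable_arclength].
Unshelve. all: by end_near. Qed.

Lemma normr_Green_le : exists M : R, forall x, `|Green lam x| <= M.
Proof.
have [K K0 H] := green_cell_lipschitz lam0; exists (`|green_cell lam 0| + K) => x.
have /andP[x0 x1] := floor_itv x; rewrite intrD in x1.
have f01 : 0 <= x - (Num.floor x)%:~R <= 1 by rewrite subr_ge0 x0 /=; lra.
have h := H 0 _ _ f01; have {}h := h (_ : 0 <= 0 <= 1); rewrite lexx ler01 in h.
rewrite Green_frac -[green_cell _ _](subrK (green_cell lam 0)) addrC.
apply: le_trans (ler_normD _ _) _; rewrite lerD2l; apply: le_trans (h isT) _.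
by case/andP: f01 => f0 f1; rewrite subr0 ger0_norm// ler_piMr.
Qed.

(** The kernel has the same mass seen from any point of the curve: in the variable
    [l * arclength v] this is the integral of a periodic function over one
    period. *)
Lemma integral_Green_arclength (u : R) : 0 <= u <= 1 ->
  \int[mu]_(v in `[0, 1]) (Gu u v * (l * p v)) =
  green_cell_primitive lam 1 - green_cell_primitive lam 0.
Proof.
move=> u01; have /andP[u0 u1] := u01; have /andP[lu0 lu1] := lP_itv u01.
have [M GM] := normr_Green_le.
have ig : mu.-integrable `[0, 1] (EFin \o (fun v => Gu u v * (l * p v))).
  apply: (integrable_boundedM (M := M)) => //; first exact: measurable_Green_arclength.
    by move=> v _; exact: GM.
  exact: integrable_scaled_speed.
have [K K0 FK] := green_cell_primitive_lipschitz lam0.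
have dF x := is_derive_green_cell_primitive x lam0.
have ige : mu.-integrable `]u, 1] (EFin \o (fun v => Gu u v * (l * p v))).
  by apply: integrableS ig => //; apply: subset_itv; rewrite bnd_simp.
(* Before u the argument of the kernel is in [-1, 0], after u it is in [0, 1]; a
   shift by the period brings the former to the cell. *)
have eq1 : \int[mu]_(v in `[0, u]) (Gu u v * (l * p v)) =
    green_cell_primitive lam 1 - green_cell_primitive lam (1 - l * arclength u).
  transitivity (\int[mu]_(v in `[0, u])
      (green_cell lam (l * arclength v + (1 - l * arclength u)) * (l * p v))).
    apply: eq_Rintegral => v; rewrite inE /= in_itv/= => /andP[v0 vu].
    have /andP[lv0 lv1] : 0 <= l * arclength v <= 1 by rewrite lP_itv// v0 (le_trans vu).
    have lvu : l * arclength v <= l * arclength u by rewrite ler_pM2l// arclength_nd.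
    rewrite /Gu Green_itvN10; first by congr (green_cell _ _ * _); ring.
    apply/andP; split; lra.
  rewrite (integral_comp_arclength l0 (lexx 0) u0 dF FK).
    by congr (green_cell_primitive _ _ - green_cell_primitive _ _); rewrite ?arclength0; ring.
  move=> v /andP[v0 vu].
  have /andP[lv0 lv1] : 0 <= l * arclength v <= 1 by rewrite lP_itv// v0 (le_trans vu).
  have lvu : l * arclength v <= l * arclength u by rewrite ler_pM2l// arclength_nd.
  apply/andP; split; lra.
have eq2 : \int[mu]_(v in `[u, 1]) (Gu u v * (l * p v)) =
    green_cell_primitive lam (1 - l * arclength u) - green_cell_primitive lam 0.
  transitivity (\int[mu]_(v in `[u, 1])
      (green_cell lam (l * arclength v + - (l * arclength u)) * (l * p v))).
    apply: eq_Rintegral => v; rewrite inE /= in_itv/= => /andP[uv v1].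
    have /andP[lv0 lv1] : 0 <= l * arclength v <= 1 by rewrite lP_itv// v1 (le_trans u0).
    have lvu : l * arclength u <= l * arclength v by rewrite ler_pM2l// arclength_nd.
    rewrite /Gu Green_itv01//; apply/andP; split; lra.
  rewrite (integral_comp_arclength l0 u0 u1 dF FK).
    by congr (green_cell_primitive _ _ - green_cell_primitive _ _); rewrite ?lP1; ring.
  move=> v /andP[uv v1].
  have /andP[lv0 lv1] : 0 <= l * arclength v <= 1 by rewrite lP_itv// v1 (le_trans u0).
  have lvu : l * arclength u <= l * arclength v by rewrite ler_pM2l// arclength_nd.
  apply/andP; split; lra.
have := Rintegral_itvB (x := u) ig _ _; rewrite !bnd_simp u0 u1 => /(_ isT isT) /eqP.
rewrite subr_eq Rintegral_itv_obnd_cbnd// eq1 eq2 => /eqP ->; ring.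
Qed.

End arclength.

(** * The vector field is controlled by the speed of the curve *)

Lemma is_derive_coord (R : realType) (g : R -> 'rV[R]_2) (u : R) (d : 'rV[R]_2) i :
  is_derive u 1 g d -> is_derive u 1 (fun v => g v 0 i) (d 0 i).
Proof.
case=> dg <-; split; first by have /derivable_mxP := dg; exact.
by rewrite derive_mx// mxE.
Qed.

Lemma W11_derivative_coord_measurable (R : realType) (g h : R -> 'rV[R]_2) i :
  W11_derivative g h -> measurable_fun (`[0%R, 1%R]%classic : set R) (fun v => g v 0 i).
Proof.
move=> [ih gE _].
apply: (eq_measurable_fun (fun v => g 0 0 i + arclength (fun w => h w 0 i) v)).
  move=> v; rewrite inE /= in_itv/= => /andP[v0 v1].
  by rewrite /arclength -gE// addrC subrK.
by apply: measurable_funD; [exact: measurable_cst|exact: measurable_arclength].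
Qed.

Lemma W11_derivative_osc (R : realType) (g h : R -> 'rV[R]_2) i (u v : R) :
  W11_derivative g h -> 0 <= u <= 1 -> 0 <= v <= 1 ->
  `|g v 0 i - g u 0 i| <= arclength (speed h) 1.
Proof.
move=> gh; have [ih gE _] := gh.
have H x y : 0 <= x -> x <= y -> y <= 1 ->
    `|g y 0 i - g x 0 i| <= arclength (speed h) 1.
  move=> x0 xy y1; rewrite gE//.
  have ihS (A : set R) : measurable A ->
      (@lebesgue_measure R).-integrable A (EFin \o (fun w => h w 0 i)).
    by move=> mA; exact: integrableS (ih i).
  have p0 w : 0 <= speed h w by exact: enorm_ge0.
  have ip := integrable_speed gh measurableT.
  apply: le_trans (le_normr_Rintegral _ (ihS _ _)) _ => //.
  apply: (@le_trans _ _ (\int[@lebesgue_measure R]_(w in `[x, y]) speed h w)).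
    apply: le_Rintegral => //.
    - exact: (integrable_abse (ihS _ _)).
    - exact: (integrable_speed gh).
    - by move=> w _; exact: ler_coord_enorm.
  rewrite -arclengthB// lerBlDr.
  apply: (@le_trans _ _ (arclength (speed h) 1)).
    by apply: arclength_nd => //; exact: le_trans xy.
  by rewrite lerDl /arclength Rintegral_ge0.
move=> /andP[u0 u1] /andP[v0 v1]; have [uv|/ltW vu] := leP u v; first exact: H.
by rewrite distrC; exact: H.
Qed.

Lemma curve_lengthE (R : realType) (g h : R -> 'rV[R]_2) :
  W11_derivative g h -> curve_length g = arclength (speed h) 1.
Proof. by move=> gh; rewrite /curve_length (integral_speed gh). Qed.

Lemma rhoE (R : realType) (g h : R -> 'rV[R]_2) (u : R) : W11_derivative g h ->
  u <= 1 -> rho g u = (curve_length g)^-1 * arclength (speed h) u.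
Proof.
move=> gh u1; rewrite /rho (integral_speed gh)//.
by apply: subset_itvl; rewrite bnd_simp.
Qed.

Lemma Gconv_coordE (R : realType) (lam : R) (g h : R -> 'rV[R]_2) (u : R) i :
  0 < lam -> W11_derivative g h -> u <= 1 ->
  Gconv lam g u 0 i = \int[@lebesgue_measure R]_(v in `[0, 1])
    (g v 0 i *
     Green lam ((curve_length g)^-1 * arclength (speed h) v -
                (curve_length g)^-1 * arclength (speed h) u) *
     ((curve_length g)^-1 * speed h v)).
Proof.
move=> lam0 gh u1; rewrite mxE; apply: ae_eq_Rintegral_measr => //.
  have mp := measurable_speed gh.
  have ip := integrable_speed gh measurableT.
  apply: measurable_funM; last first.
    apply: measurable_funM; [exact: measurable_cst|exact: measurable_funS mp].
  apply: measurable_funM; first exact: W11_derivative_coord_measurable gh.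
  exact: (measurable_Green_arclength ip).
apply: filterS (W11_derivative_ae gh) => v dg v01; rewrite dg//.
move: v01; rewrite /= in_itv/= => /andP[v0 v1].
by rewrite !(rhoE gh)// (mulrC _ (curve_length g)^-1).
Qed.

(** Moving [u] changes the kernel by at most [K / L] times the arclength travelled.
    Since the mass of the kernel does not change, the curve can be recentred at
    [g u], and the recentred curve has size at most [L]; the length cancels and
    [K] is the Lipschitz constant of the Green function. *)
Lemma Gconv_increment_le (R : realType) (lam : R) : 0 < lam ->
  exists2 K : R, 0 <= K & forall (g h : R -> 'rV[R]_2) i (u u' : R),
    W11_derivative g h -> curve_length g != 0 -> 0 <= u -> u <= u' -> u' <= 1 ->
    `|Gconv lam g u' 0 i - Gconv lam g u 0 i| <=
      K * (arclength (speed h) u' - arclength (speed h) u).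
Proof.
move=> lam0; have [K K0 GK] := Green_lipschitz lam0; exists K => // g h i u u' gh L0 u0 uu' u'1.
have u1 := le_trans uu' u'1; have u'0 := le_trans u0 uu'.
have := Gconv_coordE i lam0 gh u1; have := Gconv_coordE i lam0 gh u'1.
generalize (Gconv lam g u' 0 i), (Gconv lam g u 0 i) => A B -> ->.
set p := speed h; set L := curve_length g; set l := L^-1.
have p0 w : 0 <= p w by exact: enorm_ge0.
have ip := integrable_speed gh measurableT.
have LE : L = arclength p 1 := curve_lengthE gh.
have Lgt0 : 0 < L by rewrite lt_neqAle eq_sym L0 LE /arclength Rintegral_ge0.
have l0 : 0 < l by rewrite invr_gt0.
have lP1 : l * arclength p 1 = 1 by rewrite -LE mulVf.
pose G w v := Green lam (l * arclength p v - l * arclength p w).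
have mG w : measurable_fun (`[0%R, 1%R]%classic : set R) (G w).
  exact: (measurable_Green_arclength ip).
have mg := W11_derivative_coord_measurable i gh.
have [M GM] := normr_Green_le lam0.
have i0 : 0 <= (0 : R) <= 1 by rewrite lexx ler01.
pose N : R := `|g 0 0 i| + L.
have gN v : 0 <= v <= 1 -> `|g v 0 i| <= N.
  move=> v01; rewrite -[g v 0 i](subrK (g 0 0 i)) addrC.
  apply: le_trans (ler_normD _ _) _; rewrite lerD2l LE.
  exact: W11_derivative_osc.
have iq := integrable_scaled_speed ip l.
have u01 : 0 <= u <= 1 by rewrite u0.
have u'01 : 0 <= u' <= 1 by rewrite u'0.
have Gcst : \int[@lebesgue_measure R]_(v in `[0, 1]) (G u' v * (l * p v)) =
    \int[@lebesgue_measure R]_(v in `[0, 1]) (G u v * (l * p v)).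
  by transitivity (green_cell_primitive lam 1 - green_cell_primitive lam 0);
    [|symmetry]; exact: integral_Green_arclength.
pose dP := arclength p u' - arclength p u.
have dP0 : 0 <= dP by rewrite subr_ge0 arclength_nd.
have GP v : `|G u' v - G u v| <= K * (l * dP).
  apply: le_trans (GK _ _) _; apply: ler_wpM2l K0 _ _ _.
  rewrite (_ : _ - _ = - (l * dP)); last by rewrite /dP; ring.
  have ldP : 0 <= l * dP by apply: mulr_ge0 dP0; exact: ltW.
  by rewrite normrN (ger0_norm ldP).
have q1 : \int[@lebesgue_measure R]_(v in `[0, 1]) (l * p v) = 1.
  by rewrite -[RHS]lP1; exact: (integral_scaled_speed ip l).
have Ll : L * l = 1 by exact: (mulfV L0).
have -> : K * dP = L * (K * (l * dP)) *
    \int[@lebesgue_measure R]_(v in `[0, 1]) (l * p v).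
  by rewrite q1 mulr1 (mulrCA L) (mulrA L) Ll mul1r.
have inI v : `[0%R, 1%R]%classic v -> 0 <= v <= 1 by rewrite /= in_itv.
have gI v : `[0%R, 1%R]%classic v -> `|g v 0 i| <= N by move=> /inI; exact: gN.
have GI w v : `[0%R, 1%R]%classic v -> `|G w v| <= M by move=> _; exact: GM.
have qI v : `[0%R, 1%R]%classic v -> 0 <= l * p v.
  by move=> _; apply: mulr_ge0 (p0 v); exact: ltW.
have oI v : `[0%R, 1%R]%classic v -> `|g v 0 i - g u 0 i| <= L.
  by move=> /inI v01; rewrite LE; exact: W11_derivative_osc.
have GPI v : `[0%R, 1%R]%classic v -> `|G u' v - G u v| <= K * (l * dP).
  by move=> _; exact: GP.
exact: (@weighted_integral_diff_le _ _ R (@lebesgue_measure R) `[0%R, 1%R]%classic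
  (fun v => g v 0 i) (G u') (G u) (fun v => l * p v) (g u 0 i) N M L (K * (l * dP))
  (measurable_itv _) mg (mG u') (mG u) gI (GI u') (GI u) iq qI Gcst oI GPI).
Qed.

Lemma Fvf_coordE (R : realType) (lam : R) (g : R -> 'rV[R]_2) (u : R) i :
  curve_length g != 0 ->
  Fvf lam g u 0 i = - (1 / lam ^+ 2) * (g u 0 i + Gconv lam g u 0 i).
Proof. by move=> L0; rewrite /Fvf (negbTE L0) mxE; congr (_ * _); rewrite mxE. Qed.

(** By [Gconv_increment_le] the increments of the vector field are bounded by those
    of a multiple of arclength; where both are differentiable the derivatives
    compare.  The constant is the same for all curves, including those of zero
    length, where the field vanishes. *)
Lemma Fvf_derivative_bound (R : realType) (lam : R) : 0 < lam ->
  exists2 C : R, 0 <= C & forall (g h k : R -> 'rV[R]_2),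
    W11_derivative g h -> W11_derivative (Fvf lam g) k ->
    {ae @lebesgue_measure R, forall u : R, `[0, 1]%classic u ->
      forall i, `|k u 0 i| <= C * speed h u}.
Proof.
move=> lam0; have [K K0 GK] := Gconv_increment_le lam0.
pose m : R := 1 / lam ^+ 2.
have m0 : 0 <= m by rewrite divr_ge0// exprn_ge0// ltW.
exists (m * (1 + K)); first by rewrite mulr_ge0// addr_ge0.
move=> g h k gh Fk; have [_ _ dF] := Fk.
have p0 w : 0 <= speed h w by exact: enorm_ge0.
have [L0|L0] := eqVneq (curve_length g) 0.
  apply: ae_itv_oo_cc; apply: filterS dF => u dF u01 i; have [_ <-] := dF u01.
  rewrite /Fvf L0 eqxx derive_cst mxE normr0.
  by apply: mulr_ge0 => //; apply: mulr_ge0 => //; exact: addr_ge0.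
have ip := integrable_speed gh measurableT.
have incr i y z : 0 <= y -> y <= z -> z <= 1 ->
    `|Fvf lam g z 0 i - Fvf lam g y 0 i| <=
    m * (1 + K) * (arclength (speed h) z - arclength (speed h) y).
  move=> y0 yz z1; have h1 := GK g h i y z gh L0 y0 yz z1.
  have h2 : `|g z 0 i - g y 0 i| <= arclength (speed h) z - arclength (speed h) y.
    have [ih gE _] := gh; rewrite gE// arclengthB//.
    have ihS (A : set R) : measurable A ->
        (@lebesgue_measure R).-integrable A (EFin \o (fun w => h w 0 i)).
      by move=> mA; exact: integrableS (ih i).
    apply: le_trans (le_normr_Rintegral _ (ihS _ _)) _ => //.
    apply: le_Rintegral => //.
    - exact: (integrable_abse (ihS _ _)).
    - exact: (integrable_speed gh).
    - by move=> w _; exact: ler_coord_enorm.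
  rewrite (Fvf_coordE lam z i L0) (Fvf_coordE lam y i L0) -/m.
  move: h1; generalize (Gconv lam g z 0 i), (Gconv lam g y 0 i) => a b h1.
  rewrite (_ : _ - _ = - m * ((g z 0 i - g y 0 i) + (a - b))); last by ring.
  rewrite normrM normrN (ger0_norm m0) -mulrA ler_wpM2l// mulrDl mul1r.
  exact: le_trans (ler_normD _ _) (lerD h2 h1).
have dP := integral_is_derive_ae 0 ip.
apply: ae_itv_oo_cc; apply: filterS2 dF dP => u dF dP u01 i.
have dFi := is_derive_coord i (dF u01); move: u01; rewrite /= in_itv/= => /andP[u0 u1].
have dPu := dP u0.
(* m (1 + K) times arclength, plus or minus the field, is nondecreasing. *)
have key (e : R) : `|e| = 1 -> 0 <= m * (1 + K) * speed h u + e * k u 0 i.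
  move=> e1.
  apply: (@is_derive_ge0 R (fun v => m * (1 + K) * arclength (speed h) v +
    e * Fvf lam g v 0 i) 0 1 u); first by rewrite u0.
  move=> y z y0 yz z1; have := incr i y z (ltW y0) yz (ltW z1).
  rewrite -[X in X <= _]mul1r -e1 -normrM => /ler_normlP[+ _].
  rewrite !mulrBr; lra.
have k1 := key 1 (normr1 _); have k2 := key (-1) (normrN1 _).
rewrite ler_norml; apply/andP; split; lra.
Qed.

(** * Evolution in time of the integrated speed *)

(** Preferred to [enorm] for measuring derivatives, as it is equivalent to it and
    its triangle inequality is that of the absolute values of the coordinates. *)
Definition norm1 (R : realType) (x : 'rV[R]_2) : R := \sum_(i < 2) `|x 0 i|.

Lemma norm1_ge0 (R : realType) (x : 'rV[R]_2) : 0 <= norm1 x.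
Proof. exact: sumr_ge0. Qed.

Lemma norm1_le_enorm (R : realType) (x : 'rV[R]_2) : norm1 x <= 2 * enorm x.
Proof.
rewrite /norm1 mulr2n mulrDl mul1r !big_ord_recl big_ord0 addr0.
by apply: lerD; exact: ler_coord_enorm.
Qed.

Lemma integrable_norm1 (R : realType) (h : R -> 'rV[R]_2) (E : set R) : measurable E ->
  (forall i, (@lebesgue_measure R).-integrable setT (EFin \o (fun u => h u 0 i))) ->
  (@lebesgue_measure R).-integrable E (EFin \o (fun u => norm1 (h u))).
Proof.
move=> mE ih; apply: (integrableS measurableT) => //.
have : (@lebesgue_measure R).-integrable setT (fun u => (\sum_(i < 2) `|h u 0 i|%:E)%E).
  by apply: integrable_sum => // i _; exact: (integrable_abse (ih i)).
by apply: eq_integrable => // u _; rewrite sumEFin.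
Qed.

Lemma W11norm_ge (R : realType) (Z z : R -> 'rV[R]_2) (E : set R) :
  measurable E -> E `<=` `[0, 1]%classic ->
  (forall i, (@lebesgue_measure R).-integrable setT (EFin \o (fun u => z u 0 i))) ->
  {ae @lebesgue_measure R, forall u : R, `[0, 1]%classic u -> derive1 Z u = z u} ->
  \int[@lebesgue_measure R]_(u in E) norm1 (z u) <= 2 * W11norm Z.
Proof.
move=> mE E01 iz dZ.
have ie := integrable_enorm iz.
have ieS (A : set R) : measurable A ->
    (@lebesgue_measure R).-integrable A (EFin \o (fun u => enorm (z u))).
  by move=> mA; exact: integrableS ie.
have mz := measurable_int _ ie; have {}mz : measurable_fun setT (fun u => enorm (z u)).
  exact/measurable_EFinP.
have -> : W11norm Z = \int[@lebesgue_measure R]_(u in `[0, 1]) enorm (Z u) +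
    \int[@lebesgue_measure R]_(u in `[0, 1]) enorm (z u).
  congr (_ + _); apply: ae_eq_Rintegral_measr => //; first exact: measurable_funS mz.
  by apply: filterS dZ => u dZ u01; rewrite dZ.
have Z0 : 0 <= \int[@lebesgue_measure R]_(u in `[0, 1]) enorm (Z u).
  by apply: Rintegral_ge0 => u _; exact: enorm_ge0.
apply: (@le_trans _ _ (2 * \int[@lebesgue_measure R]_(u in `[0, 1]) enorm (z u))); last first.
  by rewrite ler_wpM2l// lerDr.
have i2 : (@lebesgue_measure R).-integrable `[0, 1] (EFin \o (fun u => norm1 (z u))).
  exact: integrable_norm1.
apply: (@le_trans _ _ (\int[@lebesgue_measure R]_(u in `[0, 1]) norm1 (z u))).
  rewrite /Rintegral fine_le//.
  - by apply: integrable_fin_num => //; exact: integrable_norm1.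
  - exact: integrable_fin_num.
  - apply: ge0_subset_integral => //.
      exact: (measurable_int _ i2).
    by move=> u _; rewrite lee_fin norm1_ge0.
rewrite -RintegralZl//; last exact: ieS.
apply: le_Rintegral => //.
- by apply: (integrable_boundedM (w := cst 2) (M := `|2|)) => //; exact: ieS.
- by move=> u _; exact: norm1_le_enorm.
Qed.

Lemma is_derive_rowB (R : realType) (f g : R -> 'rV[R]_2) (u : R) (a b : 'rV[R]_2) :
  is_derive u 1 f a -> is_derive u 1 g b -> is_derive u 1 (fun v => f v - g v) (a - b).
Proof. by move=> fa gb; exact: is_deriveB. Qed.

Lemma is_derive_rowZ (R : realType) (f : R -> 'rV[R]_2) (c u : R) (a : 'rV[R]_2) :
  is_derive u 1 f a -> is_derive u 1 (fun v => c *: f v) (c *: a).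
Proof. by move=> fa; exact: is_deriveZ. Qed.

(** With [d = s - t], the derivative of the curve at time [s] is [h0 + d (k + z)],
    where [z] is the derivative of the error of the difference quotient: [k]
    contributes the term in [C] and [z] the W^{1,1} norm of the error. *)
Lemma integral_norm1_step (R : realType) (g0 g1 f h0 h1 k : R -> 'rV[R]_2) (C d : R)
    (E : set R) : measurable E -> E `<=` `[0, 1]%classic -> d != 0 -> 0 <= C ->
  W11_derivative g0 h0 -> W11_derivative g1 h1 -> W11_derivative f k ->
  {ae @lebesgue_measure R, forall u : R, `[0, 1]%classic u ->
    forall i, `|k u 0 i| <= C * speed h0 u} ->
  `|\int[@lebesgue_measure R]_(u in E) norm1 (h1 u) -
    \int[@lebesgue_measure R]_(u in E) norm1 (h0 u)| <=
  `|d| * (2 * C * (\int[@lebesgue_measure R]_(u in E) norm1 (h0 u)) +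
          2 * W11norm (fun u => d^-1 *: (g1 u - g0 u) - f u)).
Proof.
move=> mE E01 d0 C0 [ih0 _ dg0] [ih1 _ dg1] [ik _ df] kC.
pose z u := d^-1 *: (h1 u - h0 u) - k u.
have id i : (@lebesgue_measure R).-integrable setT (EFin \o (fun u => (h1 u - h0 u) 0 i)).
  have := integrable_sub measurableT (ih1 i) (ih0 i).
  by apply: eq_integrable => // u _ /=; rewrite !mxE.
have iz i : (@lebesgue_measure R).-integrable setT (EFin \o (fun u => z u 0 i)).
  have iZ : (@lebesgue_measure R).-integrable setT
      (EFin \o (fun u => d^-1 * (h1 u - h0 u) 0 i)).
    exact: (integrable_boundedM (w := cst d^-1) (M := `|d^-1|)).
  have := integrable_sub measurableT iZ (ik i).
  by apply: eq_integrable => // u _ /=; rewrite !mxE.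
have dz : {ae @lebesgue_measure R, forall u : R, `[0, 1]%classic u ->
    derive1 (fun u => d^-1 *: (g1 u - g0 u) - f u) u = z u}.
  apply: ae_itv_oo_cc; apply: filterS3 dg0 dg1 df => u du0 du1 duf u01.
  have [_] := is_derive_rowB (is_derive_rowZ d^-1 (is_derive_rowB (du1 u01) (du0 u01)))
    (duf u01).
  by rewrite derive1E.
have zN := W11norm_ge mE E01 iz dz.
have i0 := integrable_norm1 mE ih0; have i1 := integrable_norm1 mE ih1.
have iiz := integrable_norm1 mE iz.
have ic : (@lebesgue_measure R).-integrable E (EFin \o (fun u => (2 * C) * norm1 (h0 u))).
  exact: (integrable_boundedM (w := cst (2 * C)) (M := `|2 * C|)).
have isum : (@lebesgue_measure R).-integrable E
    (EFin \o (fun u => (2 * C) * norm1 (h0 u) + norm1 (z u))).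
  exact: integrable_add.
have isumd : (@lebesgue_measure R).-integrable E
    (EFin \o (fun u => `|d| * ((2 * C) * norm1 (h0 u) + norm1 (z u)))).
  exact: (integrable_boundedM (w := cst `|d|) (M := `| `|d| |)).
rewrite -(RintegralB _ i1 i0)//.
apply: le_trans (le_normr_Rintegral _ (integrable_sub _ i1 i0)) _ => //.
have idd : (@lebesgue_measure R).-integrable E
    (EFin \o (fun u => `|norm1 (h1 u) - norm1 (h0 u)|)).
  have := integrable_abse (integrable_sub (mu := @lebesgue_measure R) mE i1 i0).
  by apply: eq_integrable.
apply: (@le_trans _ _ (\int[@lebesgue_measure R]_(u in E)
    (`|d| * ((2 * C) * norm1 (h0 u) + norm1 (z u))))).
  rewrite /Rintegral fine_le//.
  - exact: integrable_fin_num.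
  - exact: integrable_fin_num.
  - apply: ae_ge0_le_integral => //.
    + exact: (measurable_int _ idd).
    + move=> u _; rewrite lee_fin mulr_ge0// addr_ge0 ?norm1_ge0//.
      by rewrite !mulr_ge0// norm1_ge0.
    + exact: (measurable_int _ isumd).
    + apply: filterS kC => u kC /E01 u01; rewrite lee_fin.
      have {}kC i := kC u01 i.
      have h0t : speed h0 u <= norm1 (h0 u) by exact: enorm_le_sum.
      have hdE i : h1 u 0 i - h0 u 0 i = d * (z u 0 i + k u 0 i).
        rewrite /z !mxE; field; exact: d0.
      have step i : `|h1 u 0 i| - `|h0 u 0 i| <= `|d| * (`|z u 0 i| + C * norm1 (h0 u)) /\
          `|h0 u 0 i| - `|h1 u 0 i| <= `|d| * (`|z u 0 i| + C * norm1 (h0 u)).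
        have B : `|h1 u 0 i - h0 u 0 i| <= `|d| * (`|z u 0 i| + C * norm1 (h0 u)).
          rewrite hdE normrM ler_wpM2l// (le_trans (ler_normD _ _))// lerD2l.
          by apply: le_trans (kC i) _; rewrite ler_wpM2l.
        by split; apply: le_trans B; [|rewrite distrC]; exact: lerB_dist.
      have [s1 s2] := step 0; have [s3 s4] := step 1.
      have tE (x : 'rV[R]_2) : norm1 x = `|x 0 0| + `|x 0 1|.
        rewrite /norm1 !big_ord_recl big_ord0 addr0; congr (_ + `|x _ _|).
        exact: val_inj.
      have TE : `|d| * (2 * C * norm1 (h0 u) + norm1 (z u)) =
         `|d| * (`|z u 0 0| + C * norm1 (h0 u)) + `|d| * (`|z u 0 1| + C * norm1 (h0 u)).
        by rewrite (tE (z u)); ring.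
      rewrite TE (tE (h1 u)) {1}(tE (h0 u)) ler_norml; apply/andP; split; lra.
rewrite (RintegralZl _ _ isum)// (RintegralD _ ic iiz)// (RintegralZl _ _ i0)//.
by rewrite ler_wpM2l// lerD2l.
Qed.

(** Let [s] be the last time with [f 0 <= f s]: it exists by continuity, and being
    able to step to the right of it forces [s = T]. *)
Lemma right_increasing_le (R : realType) (T : R) (f : R -> R) :
  0 <= T -> {within `[0, T], continuous f} ->
  (forall t, 0 <= t -> t < T -> exists2 d, 0 < d & forall s, t < s -> s < t + d -> s <= T ->
     f t <= f s) ->
  f 0 <= f T.
Proof.
move=> T0 /subspace_continuousP cf fr.
pose S : set R := [set t | 0 <= t <= T /\ f 0 <= f t].
have S0 : S 0 by split; rewrite ?lexx.
have ubS : ubound S T by move=> t [/andP[_ tT] _].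
have hsS : has_sup S by split; [exists 0|exists T].
have s0 : 0 <= sup S by exact: ub_le_sup (proj2 hsS) _ S0.
have sT : sup S <= T by apply: ge_sup => //; exists 0.
have sin : `[0, T]%classic (sup S) by rewrite /= in_itv/= s0 sT.
have fs : f 0 <= f (sup S).
  rewrite leNgt; apply/negP => fs0.
  have e0 : 0 < f 0 - f (sup S) by rewrite subr_gt0.
  have /cvgrPdist_lt /(_ _ e0) := cf _ sin.
  rewrite near_withinE => -[d /= d0 H].
  have [t [t0T ft] td] := sup_adherent d0 hsS.
  have ts : t <= sup S by apply: ub_le_sup (proj2 hsS) _ _; split.
  have := H t; rewrite /ball/= ger0_norm ?subr_ge0// ltrBlDr -ltrBlDl.
  rewrite in_itv/= t0T => /(_ td isT).
  by rewrite -[from_subspace _ _ _ - _]/(f (sup S) - f t) => /ltr_normlP[]; lra.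
have [sTlt|] := ltP (sup S) T; last first.
  by move=> Ts; have -> : T = sup S by apply/eqP; rewrite eq_le Ts sT.
have [d d0 H] := fr _ s0 sTlt.
pose s := Num.min T (sup S + d / 2).
have ss : sup S < s by rewrite lt_min sTlt ltrDl divr_gt0.
have : S s.
  split; first by rewrite (le_trans s0 (ltW ss)) ge_min lexx.
  apply: le_trans fs _; apply: H => //; last by rewrite ge_min lexx.
  by rewrite gt_min ltrD2l ltr_pdivrMr// mulr_natr mulr2n ltrDl d0 orbT.
by move=> /(ub_le_sup (proj2 hsS)); rewrite leNgt ss.
Qed.

(** The function [m t * exp ((B + 1) t)] cannot decrease to the right of any time: at
    a zero of [m] because it is nonnegative, and elsewhere because the error [e] may
    be taken to be [m t / 2], which the margin between [B + 1 / 2] and [B + 1]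
    absorbs.  So its value at [0] is at most its value at [T], which is [0]. *)
Lemma gronwall_zero (R : realType) (T B : R) (m : R -> R) :
  0 <= T -> 0 <= B -> (forall t, 0 <= m t) ->
  (forall t, 0 <= t <= T -> forall e, 0 < e -> exists2 d, 0 < d &
    forall s, 0 <= s <= T -> `|s - t| < d -> `|m s - m t| <= `|s - t| * (B * m t + e)) ->
  m T = 0 -> m 0 = 0.
Proof.
move=> T0 B0 m0 mB mT; pose K := B + 1; pose f t := m t * expR (K * t).
suff : f 0 <= f T.
  rewrite /f mT mul0r mulr0 expR0 mulr1 => m00; apply/eqP; rewrite eq_le m00 //=.
apply: right_increasing_le => //.
  have cm : {within `[0, T], continuous m}.
    apply/subspace_continuousP => t; rewrite /= in_itv/= => tT.
    apply/cvgrPdist_lt => e e0; have [d d0 H] := mB _ tT _ ltr01.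
    have D0 : 0 < B * m t + 1 by rewrite ltr_wpDl// mulr_ge0.
    have de0 : 0 < Num.min d (e / (B * m t + 1)) by rewrite lt_min d0 divr_gt0.
    rewrite near_withinE; exists (Num.min d (e / (B * m t + 1))) => //= s.
    rewrite /ball/= lt_min distrC => /andP[sd se]; rewrite in_itv/= => sT.
    by rewrite distrC (le_lt_trans (H _ sT sd))// -ltr_pdivlMr.
  move=> t; apply: (@continuousM R (subspace `[0, T]) m (fun t => expR (K * t))).
    exact: cm.
  apply: continuous_subspaceT => {}t.
  apply: (@continuous_comp _ _ _ (fun t => K * t) expR); last exact: continuous_expR.
  exact: mulrl_continuous.
move=> t t0 tT; have tin : 0 <= t <= T by rewrite t0 ltW.
have [mt0|mt0] := eqVneq (m t) 0.
  by exists 1 => // s _ _ _; rewrite /f mt0 mul0r mulr_ge0 ?m0 ?expR_ge0.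
have mt : 0 < m t by rewrite lt_neqAle eq_sym mt0 m0.
have [d d0 H] := mB _ tin _ (divr_gt0 mt (ltr0Sn R 1)).
(* On steps x < 1 / (2 b K) the bounds m s >= m t (1 - b x) and exp (K x) >= 1 + K x
   multiply to at least m t. *)
pose b := B + 1 / 2.
have bK0 : 0 < 2 * b * K by rewrite !mulr_gt0// ltr_wpDl// divr_gt0.
exists (Num.min d (2 * b * K)^-1); first by rewrite lt_min d0 invr_gt0.
move=> s ts; rewrite -ltrBlDl lt_min => /andP[sd sb] sT.
have x0 : 0 < s - t by rewrite subr_gt0.
have := H s _ _; rewrite (gtr0_norm x0) sd sT (le_trans t0 (ltW ts)) => /(_ isT isT).
move=> /ler_normlP[+ _].
have -> : f s = m s * expR (K * (s - t)) * expR (K * t).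
  by rewrite /f -mulrA -expRD -mulrDr subrK.
rewrite /f.
set x := s - t in x0 sd sb *; move=> ms.
have ex : 1 + K * x <= expR (K * x) by exact: expR_ge1Dx.
have xbK : x * (2 * b * K) <= 1 by rewrite -ler_pdivlMr// mul1r ltW.
rewrite ler_wpM2r ?expR_ge0//.
have K1 : 1 <= K by rewrite lerDr.
have b0 : 0 < b by rewrite ltr_wpDl// divr_gt0.
have xb : x * b <= 1 / 2.
  have : x * b * 1 <= x * b * K by rewrite ler_wpM2l// ltW// mulr_gt0.
  lra.
have ms' : m t * (1 - x * b) <= m s.
  have -> : m t * (1 - x * b) = m t - x * (B * m t + m t / 2) by rewrite /b; field.
  lra.
apply: (@le_trans _ _ (m t * (1 - x * b) * (1 + K * x))).
  have -> : m t * (1 - x * b) * (1 + K * x) =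
      m t + m t * x * (1 / 2 - x * b * K) by rewrite /b /K; field.
  rewrite lerDl mulr_ge0//; first by rewrite mulr_ge0// ltW.
  lra.
apply: ler_pM => //.
  by rewrite mulr_ge0// subr_ge0; lra.
by rewrite addr_ge0// mulr_ge0// ltW// (lt_le_trans ltr01 K1).
Qed.

Lemma is_derive_W11_step (R : realType) (I : set R) (X Y : R -> R -> 'rV[R]_2) (t e : R) :
  is_derive_W11 I X Y -> I t -> 0 < e -> exists2 d, 0 < d &
    forall s, I s -> s != t -> `|s - t| < d ->
      W11norm (fun u => (s - t)^-1 *: (X s u - X t u) - Y t u) < e.
Proof.
move=> [_ H] It e0; have /cvgrPdist_lt /(_ _ e0) := H _ It.
rewrite near_withinE /= => -[d /= d0 Hd]; exists d => // s Is st sd.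
have := Hd s; rewrite /ball/= distrC => /(_ sd st Is).
by rewrite sub0r normrN => /ltr_normlP[].
Qed.

(** * Solutions stay immersed *)

Theorem lemma5p4 (R : realType) (lam : R) (hlam : 0 < lam)
    (X0 : R -> 'rV[R]_2) (hX0 : W11Imm R X0)
    (T0 : R) (hT0 : 0 < T0)
    (X : R -> R -> 'rV[R]_2)
    (hX : is_solution lam `[0, T0] X)
    (hinit : forall u : R, `[0, 1]%classic u -> X 0 u = X0 u) :
  C1_into `[0, T0] (W11Imm R) X.
Proof.
have [[WX XC1] XF] := hX; split=> [t0 t0T|]; last exact: XC1.
split; first exact: WX.
have /choice[h hP] : forall t, exists h, `[0, T0]%classic t -> W11_derivative (X t) h.
  move=> t; have [tT|] := pselect (`[0, T0]%classic t); last by exists 0.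
  by have [h] := W11_has_derivative (WX _ tT); exists h.
have [C C0 FC] := Fvf_derivative_bound hlam.
(* The candidate degenerate set at time t0, to be shown negligible. *)
pose E := `[0%R, 1%R]%classic `&` (fun u => norm1 (h t0 u)) @^-1` [set 0].
have [iht0 _ _] := hP _ t0T.
have mE : measurable E.
  have mt : measurable_fun (`[0%R, 1%R]%classic : set R) (fun u => norm1 (h t0 u)).
    by have := integrable_norm1 (measurable_itv `[0, 1]) iht0 => /measurable_int/measurable_EFinP.
  by have := mt (measurable_itv _) [set 0] (measurable_set1 _).
have E01 : E `<=` `[0, 1]%classic by move=> u [].
pose m t := \int[@lebesgue_measure R]_(u in E) norm1 (h t u).
move: (t0T); rewrite /= in_itv/= => /andP[t00 t0T0].
have inI t : 0 <= t <= t0 -> `[0, T0]%classic t.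
  by move=> /andP[t1 t2]; rewrite /= in_itv/= t1 (le_trans t2).
have mt0 : m t0 = 0.
  transitivity (\int[@lebesgue_measure R]_(u in E) (0 : R)).
    by apply: eq_Rintegral => u /set_mem[].
  by rewrite /Rintegral integral0.
have m00 : m 0 = 0.
  apply: (@gronwall_zero R t0 (2 * C) m) => //.
  - by rewrite mulr_ge0.
  - by move=> t; apply: Rintegral_ge0 => u _; exact: norm1_ge0.
  - move=> t /inI tT e e0; have [WF _] := XF.
    have [k Fk] := W11_has_derivative (proj2 (WF _ tT)).
    have kC := FC _ _ _ (hP _ tT) Fk.
    have [d d0 Hd] := is_derive_W11_step XF tT (divr_gt0 e0 (ltr0Sn R 1)).
    exists d => // s /inI sT sd; have [->|st] := eqVneq s t.
      by rewrite !subrr !normr0 mul0r.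
    have st0 : s - t != 0 by rewrite subr_eq0.
    have := integral_norm1_step mE E01 st0 C0 (hP _ tT) (hP _ sT) Fk kC.
    move=> /le_trans; apply; rewrite ler_wpM2l// lerD2l.
    have := Hd s sT st sd; rewrite ltr_pdivlMr// mulrC => /ltW; exact.
have zT : `[0, T0]%classic 0 by rewrite /= in_itv/= lexx ltW.
have [ih0 _ dh0] := hP _ zT.
have i0 := integrable_norm1 mE ih0.
have ae0 : {ae @lebesgue_measure R, forall u : R, E u -> norm1 (h 0 u) = 0}.
  have mh := measurable_int _ i0.
  have : (\int[@lebesgue_measure R]_(u in E) `|(EFin \o (fun u => norm1 (h 0%R u))) u| = 0)%E.
    transitivity (\int[@lebesgue_measure R]_(u in E) (norm1 (h 0%R u))%:E)%E.
      by apply: eq_integral => u _; rewrite gee0_abs// lee_fin norm1_ge0.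
    rewrite -[LHS]fineK; last exact: integrable_fin_num.
    by rewrite -[fine _]/(m 0) m00.
  move=> H0; have := proj1 (ae_eq_integral_abs (@lebesgue_measure R) mE mh) H0.
  apply: filterS => u H Eu.
  by have [] := H Eu.
have h0gt : {ae @lebesgue_measure R, forall u : R, `]0, 1[%classic u -> 0 < enorm (h 0 u)}.
  have [_ X0gt] := hX0; apply: filterS2 dh0 X0gt => u dX X0u u01.
  have [u0 u1] : 0 < u /\ u < 1 by move: u01; rewrite /= in_itv/= => /andP[].
  have near_eq : \near u, X 0 u = X0 u.
    have u0' : nbhs u (`]0, 1[%classic : set R) by exact: near_in_itvoo.
    by apply: filterS u0' => v; rewrite /= in_itv/= => /andP[v0 v1]; apply: hinit;
      rewrite /= in_itv/= !ltW.
  have [_ dX0] := near_eq_is_derive near_eq (dX u01).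
  by rewrite -dX0 -derive1E; apply: X0u; rewrite /= in_itv/= !ltW.
apply: ae_itv_oo_cc; apply: filterS3 ae0 h0gt (W11_derivative_ae (hP _ t0T)) => u u0 ugt du u01.
have u01c : `[0, 1]%classic u.
  by move: u01; rewrite /= !in_itv/= => /andP[v0 v1]; rewrite !ltW.
rewrite du// lt_neqAle enorm_ge0 andbT eq_sym; apply/negP => /eqP hu.
have Eu : E u.
  split => //; apply/eqP; rewrite eq_le norm1_ge0 andbT.
  by apply: le_trans (norm1_le_enorm _) _; rewrite hu mulr0.
by have := lt_le_trans (ugt u01) (enorm_le_sum _); rewrite -/(norm1 _) u0// ltxx.
Qed.
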